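(* Consider the principal–agent game described in the context, under the standing assumptions (A1) and (A2). Suppose $(a,F_P,F_A)$ is an equilibrium with beneficial search. Then there exists $\tau_M>0$ such that: (i) the agent's faking-time distribution $F_A$ has no mass points (atoms) and its support is the whole interval $[\tau_M,\tau_P]$ (no gaps); (ii) the support of the principal's stopping-time distribution $F_P$ is the whole interval $[\tau_M,\tau_P]$ (no gaps), and $\tau_P$ is the only possible mass point of $F_P$; (iii) $a(t)=1$ for all $t\ge 0$, i.e. the principal selects the risky action following type-1 news at all times.
   Context: Parameters and primitives. $\theta\in(0,1)$, $\beta\in(0,\theta)$, $\beta<\mu<\theta$, $\rho>0$, $\sigma\in(0,1)$. $G$ is the CDF of a probability distribution on $[0,\infty)$ with continuous density $g$, $G(t)<1$ for all $t<\infty$, and strictly decreasing hazard rate $H_R(t)=g(t)/(1-G(t))$; $H_R(\infty)=\lim_{t\to\infty}H_R(t)$. Let $\phi_P=\frac{\rho\theta}{\mu(1-\theta)}$, $\phi_A=\frac{\rho\mu}{\beta(1-\mu)}$. Standing assumptions: (A1) $H_R(0)>\phi_P>H_R(\infty)$; (A2) $\phi_P>\phi_A$. $\tau_P\in(0,\infty)$ is the unique solution of $H_R(\tau_P)=\phi_P$. Interpretation. The risky action pays both players $\omega\in\{0,1\}$ with $\Pr(\omega=1)=\mu$; the safe action pays the principal $\theta$ and the agent $\beta$. Real news, revealing $\omega$ (''type-$\omega$ news''), arrives at a time with CDF $G$ independent of $\omega$. With probability $\sigma$ the agent is manipulative and can fake type-1 news at a time of his choice. The principal stops and chooses safe at a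 chosen time if no news has arrived; she chooses safe after type-0 news and, after type-1 news at time $t$, chooses risky with probability $a(t)$. Strategies. For $i\in\{A,P\}$, the agent's faking time ($i=A$) and the principal's stopping time ($i=P$) are drawn from a probability measure on $[0,\infty]$ with $F_i(t)=\int_0^t f_i^*(s)\,ds+\sum_{m:\,t_m\le t}f_m$ for $t<\infty$, where $f_i^*\ge0$ is a density, $\{t_m\}$ is a countable set of atoms with probabilities $f_m>0$, and the remaining mass sits at $\infty$ (never). Write $f_i=f_i^*+\sum_m f_m\delta_{t_m}$; integrals over $[0,t]$ include atoms at the endpoints $0$ and $t$, and differences such as $u_i(t')-u_i(t)$ accordingly involve $(t,t']$. ''$f_i(t)>0$'' means $f_i^*(t)>0$ or $t$ is an atom (an atom at $\infty$ included); ''$f_i(t)=0$'' is its negation. The principal also chooses a measurable $a:[0,\infty)\to[0,1]$. Principal's payoff. $w_0^P(s)=(1-\mu)g(s)(1-\sigma F_A(s))$, $w_1^P(s)=\mu g(s)(1-\sigma F_A(s))+\sigma f_A(s)(1-G(s))$, $W^P_\phi(t)=(1-G(t))(1-\sigma F_A(t))$, and $$\mu_1(s)=\frac{\mu g(s)(1-\sigma F_A(s))+\mu\sigma f_A(s)(1-G(s))}{\mu g(s)(1-\sigma F_A(s))+\sigma f_A(s)(1-G(s))},$$ with $\mu_1(s)=\mu$ at an atom $s$ of $F_A$. Then $$u_P(t)=\int_0^t e^{-\rho s}\{w_0^P(s)\theta+w_1^P(s)((1-a(s))\theta+a(s)\mu_1(s))\}ds+e^{-\rho t}W^P_\phi(t)\theta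 .$$ Agent's payoff. $w_0^A(s)=(1-\mu)g(s)(1-F_P(s))$, $w_1^A(s)=\mu g(s)(1-F_P(s))$, $w_S^A(s)=f_P(s)(1-G(s))$, $W^A_\phi(t)=(1-G(t))(1-F_P(t))$, and $$u_A(t)=\int_0^t e^{-\rho s}\{w_0^A(s)\beta+w_1^A(s)((1-a(s))\beta+a(s))+w_S^A(s)\beta\}ds+e^{-\rho t}W^A_\phi(t)((1-a(t))\beta+\mu a(t)).$$ At $t=\infty$ the last term of $u_P$ and $u_A$ is $0$. Equilibrium. $(a,F_P,F_A)$ is an equilibrium iff: (AIC) $f_A(t)>0\Rightarrow u_A(t)\ge u_A(t')$ for all $t,t'\in[0,\infty]$; (PICa) for all $t\ge0$, $a(t)=1$ if $\mu_1(t)>\theta$, $a(t)\in[0,1]$ if $\mu_1(t)=\theta$, $a(t)=0$ if $\mu_1(t)<\theta$; (PICt) $f_P(t)>0\Rightarrow u_P(t)\ge u_P(t')$ for all $t,t'\in[0,\infty]$. The equilibrium payoff of player $i$ is the expectation of $u_i$ under $F_i$ (for $i=A$: the manipulative agent). An equilibrium has beneficial search if the principal's equilibrium payoff is strictly greater than $\theta$. *)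

(* Defs.v *)
From HB Require Import structures.
From mathcomp Require Import all_boot all_order all_algebra.
From mathcomp Require Import all_classical all_reals all_analysis.
From mathcomp Require Import measurable_realfun.
Set Implicit Arguments.
Unset Strict Implicit.
Unset Printing Implicit Defensive.
Import Order.TTheory GRing.Theory Num.Theory.
Import numFieldNormedType.Exports.
Local Open Scope classical_set_scope.
Local Open Scope ring_scope.

Record game (R : realType) := Game {
  theta : R;
  beta : R;
  mu : R;
  rho : R;
  sigma : R;
  g : R -> R  (* density of the arrival time of real news; only its values on
                 [0, +oo[ matter *)
}.

(* The CDF of the arrival time of real news, for t >= 0. *)
Definition G (R : realType) (E : game R) (t : R) : R :=
  \int[lebesgue_measure]_(s in `[0, t]) g E s.

Definition hazard (R : realType) (E : game R) (t : R) : R :=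
  g E t / (1 - G E t).

Definition phiP (R : realType) (E : game R) : R :=
  rho E * theta E / (mu E * (1 - theta E)).

Definition phiA (R : realType) (E : game R) : R :=
  rho E * mu E / (beta E * (1 - mu E)).

Record admissible (R : realType) (E : game R) : Prop := Admissible {
  theta_bounds : 0 < theta E < 1;
  beta_bounds : 0 < beta E < theta E;
  mu_bounds : beta E < mu E < theta E;
  rho_gt0 : 0 < rho E;
  sigma_bounds : 0 < sigma E < 1;
  g_continuous : {within `[0, +oo[, continuous (g E)};
  g_ge0 : forall t : R, 0 <= t -> 0 <= g E t;
  g_total : (\int[lebesgue_measure]_(s in `[0%R, +oo[) (g E s)%:E = 1)%E;
  G_lt1 : forall t : R, 0 <= t -> G E t < 1;
  hazard_decreasing :
    forall s t : R, 0 <= s -> s < t -> hazard E t < hazard E s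
}.

Section Timing.
Variable R : realType.

(* The law of a random time in [0, +oo], the point +oo standing for "never",
   together with a pointwise chosen version of the density of its absolutely
   continuous part. On [0, +oo[ the law is that density plus its atoms. *)
Record timing := Timing {
  law : probability (\bar R) R;
  dens : R -> R;
  law_ge0 : law [set x : \bar R | (0 <= x)%E] = 1%E;
  dens_measurable : measurable_fun (`[0, +oo[ : set R) dens;
  dens_ge0 : forall s : R, 0 <= s -> 0 <= dens s;
  law_decomposition : forall t : R, 0 <= t ->
    law [set x : \bar R | (x <= t%:E)%E] =
      (\int[lebesgue_measure]_(s in `[0%R, t]) (dens s)%:E
       + \esum_(s in `[0%R, t]) law [set s%:E])%E
}.

Definition cdf_of (F : timing) (t : R) : R :=
  fine (law F [set x : \bar R | (x <= t%:E)%E]).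

Definition is_atom (F : timing) (x : \bar R) : bool := (0 < law F [set x])%E.

(* "f(x) > 0" for the generalised density f of F. *)
Definition charged (F : timing) (x : \bar R) : Prop :=
  is_atom F x \/ exists2 r : R, x = r%:E & 0 < dens F r.

(* The integral over D of h f, where f = dens + sum of m_s delta_s is the
   generalised density of F. *)
Definition timing_integral (F : timing) (D : set R) (h : R -> R) : \bar R :=
  (\int[lebesgue_measure]_(s in D) (dens F s * h s)%:E
   + \esum_(s in D) (fine (law F [set s%:E]) * h s)%:E)%E.

Definition support_of (F : timing) : set (\bar R) :=
  [set x | forall U : set (\bar R), open U -> U x -> (0 < law F U)%E].

(* t |-> probability of the risky action after type-1 news at time t. *)
Record acceptance := Acceptance {
  accept :> R -> R;
  accept_measurable : measurable_fun (`[0, +oo[ : set R) accept;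
  accept_bounds : forall t : R, 0 <= t -> 0 <= accept t <= 1
}.

End Timing.

Section Payoffs.
Variables (R : realType) (E : game R).
Variables (a : acceptance R) (FP FA : timing R).

(* Posterior that the state is 1 after type-1 news at time s. *)
Definition mu1 (s : R) : R :=
  if is_atom FA s%:E then mu E else
  (mu E * g E s * (1 - sigma E * cdf_of FA s)
     + mu E * sigma E * dens FA s * (1 - G E s))
  / (mu E * g E s * (1 - sigma E * cdf_of FA s)
     + sigma E * dens FA s * (1 - G E s)).

(* Principal's expected undiscounted payoff given type-1 news at time s. *)
Definition type1P (s : R) : R :=
  (1 - a s) * theta E + a s * mu1 s.

(* The weight w_1^P of type-1 news is affine in f_A: its genuine part is kept
   in the Lebesgue integral, and its faked part sigma f_A (1 - G) is integrated
   against the generalised density f_A. *)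
Definition flowP (D : set R) : \bar R :=
  (\int[lebesgue_measure]_(s in D)
     (expR (- (rho E * s)) *
      ((1 - mu E) * g E s * (1 - sigma E * cdf_of FA s) * theta E
       + mu E * g E s * (1 - sigma E * cdf_of FA s) * type1P s))%:E
   + timing_integral FA D
       (fun s => (expR (- (rho E * s)) *
                  (sigma E * (1 - G E s) * type1P s))%R))%E.

Definition no_newsP (t : R) : R :=
  (1 - G E t) * (1 - sigma E * cdf_of FA t).

(* uP and uA are only meaningful on [0, +oo]. *)
Definition uP (x : \bar R) : \bar R :=
  match x with
  | t%:E => (flowP `[0%R, t]
             + (expR (- (rho E * t)) * no_newsP t * theta E)%:E)%E
  | +oo => flowP `[0%R, +oo[
  | -oo => 0
  end%E.

Definition flowA (D : set R) : \bar R :=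
  (\int[lebesgue_measure]_(s in D)
     (expR (- (rho E * s)) *
      ((1 - mu E) * g E s * (1 - cdf_of FP s) * beta E
       + mu E * g E s * (1 - cdf_of FP s) * ((1 - a s) * beta E + a s)))%:E
   + timing_integral FP D
       (fun s => (expR (- (rho E * s)) * ((1 - G E s) * beta E))%R))%E.

Definition no_newsA (t : R) : R := (1 - G E t) * (1 - cdf_of FP t).

Definition uA (x : \bar R) : \bar R :=
  match x with
  | t%:E => (flowA `[0%R, t]
             + (expR (- (rho E * t)) * no_newsA t *
                ((1 - a t) * beta E + mu E * a t))%:E)%E
  | +oo => flowA `[0%R, +oo[
  | -oo => 0
  end%E.

Definition AIC : Prop := forall t t' : \bar R, (0 <= t)%E -> (0 <= t')%E ->
  charged FA t -> (uA t' <= uA t)%E.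

Definition PICa : Prop := forall t : R, 0 <= t ->
  [/\ (theta E < mu1 t -> a t = 1),
      (mu1 t = theta E -> 0 <= a t <= 1) &
      (mu1 t < theta E -> a t = 0)].

Definition PICt : Prop := forall t t' : \bar R, (0 <= t)%E -> (0 <= t')%E ->
  charged FP t -> (uP t' <= uP t)%E.

Definition equilibrium : Prop := [/\ AIC, PICa & PICt].

Definition payoffP : \bar R :=
  (\int[law FP]_(x in [set x | (0 <= x)%E]) uP x)%E.

Definition beneficial_search : Prop := ((theta E)%:E < payoffP)%E.

End Payoffs.

(* Main.v *)
(* Integrating by parts, the principal's payoff from stopping at t is theta plus the integral over
   [0, t] of a drift that is at most a positive multiple of hazard - phiP, with equality where
   nothing is faked, and negative where a < 1; so she never stops after tauP. The agent's payoff
   from an accepted fake at t has, while the principal does not stop, drift a positive multiple of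
   hazard - phiA minus a term proportional to 1 - a, and drops where she stops.

   If a < 1 somewhere, fakes are charged there, so the agent is indifferent and the principal loses
   by waiting, hence does not stop; following this region to its right end, where a must come back
   to 1, contradicts the positive drift. So a = 1, which rules out atoms of FA. A gap in the
   principal's law makes the agent strictly prefer waiting through it, which stops the faking, which
   in turn makes the principal strictly prefer waiting: so neither law has a gap before tauP. An
   atom of FP before tauP would make the agent skip an interval right after it. *)

Require Import Defs.
From HB Require Import structures.
From mathcomp Require Import all_boot all_order all_algebra.
From mathcomp Require Import all_classical all_reals all_analysis.
From mathcomp Require Import measurable_realfun.
From mathcomp Require Import ring lra.
Import Order.TTheory GRing.Theory Num.Theory.
Import numFieldNormedType.Exports.
Local Open Scope classical_set_scope.
Local Open Scope ring_scope.
Set Implicit Arguments.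
Unset Strict Implicit.
Unset Printing Implicit Defensive.

(** * Integrals over [0, t] as functions of t *)

(** Neither [a] nor the densities of the laws are continuous, and both laws may have atoms, so
    payoffs cannot be differentiated. They are written as cumulative Lebesgue integrals of drifts
    and compared through pointwise bounds on those drifts. Integration by parts against a law with
    atoms rests on [cst_of_incr]: a defect whose increments are of second order, at most
    [C * (s - r) * (F s - F r)], is constant. The principal's payoff has a bounded drift and no
    jumps, because a report at an atom of [FA] is rejected and optimal acceptance never loses
    against the safe action. It is therefore Lipschitz, and stopping is optimal even at mere limits
    of charged times, such as the left end of a gap. The agent's payoff lacks this: [a] may jump,
    and so does the law of the principal. Hence the detour through [acceptedA], in which [a] enters
    only under the integral. Incentives speak of [charged] points. An uncharged interval has a
    constant cdf, but a constant cdf allows a positive density on a null set, so the way back from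
    the cdf to the drift has to go through integrals. *)

Section Cumulative.
Variable R : realType.
Local Notation leb := (@lebesgue_measure R).
Implicit Types (f : R -> R) (c s t : R).

Lemma integrable_itvS f s t : s <= t ->
  leb.-integrable `[0, t] (EFin \o f) -> leb.-integrable `[0, s] (EFin \o f).
Proof.
move=> st; apply: integrableS => //.
by apply: subset_itvl; rewrite bnd_simp.
Qed.

(** This and its mirror image play the part of the mean value inequality: a bound on the integrand
    over the open interval bounds the increment. *)
Lemma cumul_incr_le f c s t : 0 <= s -> s <= t ->
  leb.-integrable `[0, t] (EFin \o f) ->
  (forall x, s < x -> x < t -> f x <= c) ->
  \int[leb]_(x in `[0, t]) f x - \int[leb]_(x in `[0, s]) f x <= c * (t - s).
Proof.
move=> s0 st fi fc.
rewrite Rintegral_itvB ?bnd_simp//.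
have fio : leb.-integrable `]s, t[ (EFin \o f).
  apply: integrableS fi => // x /=; rewrite !in_itv/= => /andP[sx xt].
  by rewrite (le_trans s0 (ltW sx)) ltW.
rewrite -Rintegral_itv_bndo_bndc//.
have -> : c * (t - s) = \int[leb]_(x in `]s, t[) c.
  rewrite Rintegral_cst//; congr (_ * _).
  have := @lebesgue_measure_itv R `]s, t[.
  rewrite /= lte_fin => ->; case: ltP => //= ts.
  by have -> : t = s by [apply/eqP; rewrite eq_le ts st]; rewrite subrr.
apply: le_Rintegral => //.
  apply: measurable_bounded_integrable => //=.
    have := @lebesgue_measure_itv R `]s, t[.
    by rewrite /= lte_fin => ->; case: ifP => _; rewrite -?EFinB ltry.
  exact: bounded_cst.
by move=> x /=; rewrite in_itv/= => /andP[]; exact: fc.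
Qed.

Lemma cumul_incr_ge f c s t : 0 <= s -> s <= t ->
  leb.-integrable `[0, t] (EFin \o f) ->
  (forall x, s < x -> x < t -> c <= f x) ->
  c * (t - s) <= \int[leb]_(x in `[0, t]) f x - \int[leb]_(x in `[0, s]) f x.
Proof.
move=> s0 st fi fc.
have fNi : leb.-integrable `[0, t] (EFin \o (fun x => (-1) * f x)).
  have := @integrableZl _ _ _ leb `[0, t] (measurable_itv _) (-1) _ fi.
  by apply: eq_integrable => // x _ /=.
have := @cumul_incr_le (fun x => (-1) * f x) (- c) s t s0 st fNi.
rewrite !RintegralZl//; last exact: (integrable_itvS st).
move=> H; rewrite -lerN2 -mulNr opprB; apply: le_trans (H _); first by rewrite !mulN1r opprK addrC.
by move=> x sx xt; rewrite mulN1r lerN2; exact: fc.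
Qed.

(* Over a partition of [0, t] into n equal pieces, the increments of Phi sum to at most
   C t (F t - F 0) / n. *)
Lemma cst_of_incr (Phi F : R -> R) (C t : R) : 0 <= t -> 0 <= C ->
  (forall r s, 0 <= r -> r <= s -> s <= t ->
     `|Phi s - Phi r| <= C * (s - r) * (F s - F r)) ->
  Phi t = Phi 0.
Proof.
move=> t0 C0 H; apply/eqP; rewrite -subr_eq0 -normr_le0; apply/ler_addgt0Pr => e e0.
rewrite add0r.
set B := C * t * (F t - F 0).
have [n nB] : exists n, B <= e * n.+1%:R.
  exists (Num.truncn (B / e)); rewrite mulrC -ler_pdivrMr//.
  exact/ltW/truncnS_gt.
pose p (k : nat) := t * (k%:R / n.+1%:R).
have pS k : p k.+1 - p k = t / n.+1%:R.
  by rewrite /p -mulrBr -mulrBl -natrB// subSnn mul1r.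
have dp0 : 0 <= t / n.+1%:R by rewrite divr_ge0.
suff S k : (k <= n.+1)%N ->
    `|Phi (p k) - Phi 0| <= C * (t / n.+1%:R) * (F (p k) - F 0).
  have := S n.+1 (leqnn _); rewrite /p divff ?pnatr_eq0// mulr1 => /le_trans; apply.
  by rewrite mulrA mulrAC -/B ler_pdivrMr.
elim: k => [_|k IH kn]; first by rewrite /p mul0r mulr0 !subrr normr0 mulr0.
have p0 j : 0 <= p j by rewrite mulr_ge0// divr_ge0.
have pt : p k.+1 <= t.
  by rewrite -[leRHS]mulr1 ler_wpM2l// ler_pdivrMr// mul1r ler_nat.
have pp : p k <= p k.+1 by rewrite -subr_ge0 pS.
have := H _ _ (p0 k) pp pt; rewrite pS => H1.
have := IH (ltnW kn) => H2.
rewrite (_ : Phi (p k.+1) - Phi 0 = (Phi (p k.+1) - Phi (p k)) + (Phi (p k) - Phi 0)); last by ring.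
apply: (le_trans (ler_normD _ _)); apply: (le_trans (lerD H1 H2)).
by rewrite -mulrDr subrKA.
Qed.

End Cumulative.

(** * Laws of random times *)

Lemma ge0_esumZl (R : realType) (I : choiceType) (D : set I) (a : I -> \bar R)
    (c : R) : 0 <= c -> (forall i, D i -> (0 <= a i)%E) ->
  (\esum_(i in D) (c%:E * a i) = c%:E * \esum_(i in D) a i)%E.
Proof.
move=> c0 a0; rewrite esum_mkcond [in RHS]esum_mkcond.
set b := fun i => if i \in D then a i else 0%E.
have b0 i : (0 <= b i)%E by rewrite /b; case: ifPn => // /set_mem/a0.
rewrite (_ : (fun i => if i \in D then _ else _) = (fun i => (c%:E * b i)%E)); last first.
  by apply/funext => i; rewrite /b; case: ifPn => //; rewrite mule0.
rewrite /esum -ereal_supZl//; last first.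
  by apply/set0P; exists (\sum_(x \in set0) b x)%E, set0.
congr ereal_sup; apply/seteqP; split => [x [A fA <-]|x [_ [A fA <-] <-]].
  by exists (\sum_(i \in A) b i)%E; [exists A|rewrite ge0_mule_fsumr].
by exists A => //; rewrite ge0_mule_fsumr.
Qed.

Section Timing.
Variables (R : realType) (F : timing R).
Local Notation leb := (@lebesgue_measure R).
Local Notation TI := (timing_integral F).
Local Notation cdf := (cdf_of F).
Implicit Types (r s t c : R) (h : R -> R).

Lemma law_fin (A : set (\bar R)) : measurable A -> law F A \is a fin_num.
Proof. by move=> mA; exact: fin_num_measure. Qed.

Lemma measurable_ereal_le (x : \bar R) : measurable [set y : \bar R | (y <= x)%E].
Proof.
rewrite (_ : [set y : \bar R | (y <= x)%E] = `]-oo, x]%classic); first exact: emeasurable_itv.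
by apply/seteqP; split => y /=; rewrite in_itv.
Qed.

Lemma cdf_of_law t : (cdf t)%:E = law F [set x : \bar R | (x <= t%:E)%E].
Proof. by rewrite /cdf_of fineK//; apply: law_fin; exact: measurable_ereal_le. Qed.

Lemma atom_ge0 s : 0 <= fine (law F [set s%:E]).
Proof. by rewrite fine_ge0. Qed.

Lemma dens_measurableS (D : set R) : D `<=` `[0, +oo[ -> measurable D ->
  measurable_fun D (dens F).
Proof.
by move=> D0 mD; apply: measurable_funS (dens_measurable F) => //; exact: measurable_itv.
Qed.

Lemma ge0_itvP r : `[0, +oo[%classic r <-> 0 <= r.
Proof. by rewrite /= in_itv/= andbT. Qed.

Lemma timing_integral_ge0 (D : set R) h : D `<=` `[0, +oo[ ->
  (forall s, D s -> 0 <= h s) -> (0 <= TI D h)%E.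
Proof.
move=> D0 h0; apply: adde_ge0.
  apply: integral_ge0 => s Ds; rewrite lee_fin mulr_ge0 ?h0//.
  by apply: dens_ge0; exact/ge0_itvP/D0.
by apply: esum_ge0 => s Ds; rewrite lee_fin mulr_ge0 ?h0// atom_ge0.
Qed.

Lemma le_timing_integral (D : set R) h1 h2 : D `<=` `[0, +oo[ -> measurable D ->
  measurable_fun D h1 -> measurable_fun D h2 ->
  (forall s, D s -> 0 <= h1 s <= h2 s) -> (TI D h1 <= TI D h2)%E.
Proof.
move=> D0 mD m1 m2 h12; apply: leeD.
  apply: ge0_le_integral => //=.
  - move=> s Ds; rewrite lee_fin mulr_ge0 ?(andP (h12 _ Ds)).1//.
    by apply: dens_ge0; exact/ge0_itvP/D0.
  - by apply/measurable_EFinP; apply: measurable_funM => //; exact: dens_measurableS.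
  - by apply/measurable_EFinP; apply: measurable_funM => //; exact: dens_measurableS.
  - move=> s Ds; rewrite lee_fin ler_wpM2l ?(andP (h12 _ Ds)).2//.
    by apply: dens_ge0; exact/ge0_itvP/D0.
by apply: le_esum => s Ds; rewrite lee_fin ler_wpM2l ?atom_ge0 ?(andP (h12 _ Ds)).2.
Qed.

Lemma timing_integralZl (D : set R) h c : D `<=` `[0, +oo[ -> measurable D ->
  measurable_fun D h -> 0 <= c ->
  (forall s, D s -> 0 <= h s) -> TI D (fun s => c * h s) = (c%:E * TI D h)%E.
Proof.
move=> D0 mD mh c0 h0; rewrite /timing_integral ge0_muleDr; last 2 first.
- apply: integral_ge0 => s Ds; rewrite lee_fin mulr_ge0 ?h0//.
  by apply: dens_ge0; exact/ge0_itvP/D0.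
- by apply: esum_ge0 => s Ds; rewrite lee_fin mulr_ge0 ?h0// atom_ge0.
congr (_ + _)%E.
  rewrite -ge0_integralZl_EFin//.
  - by apply: eq_integral => s _; rewrite -EFinM mulrCA.
  - move=> s Ds; rewrite lee_fin mulr_ge0 ?h0//.
    by apply: dens_ge0; exact/ge0_itvP/D0.
  - by apply/measurable_EFinP; apply: measurable_funM => //; exact: dens_measurableS.
rewrite -ge0_esumZl//; last by move=> s Ds; rewrite lee_fin mulr_ge0 ?h0// atom_ge0.
by apply: eq_esum => s _; rewrite -EFinM mulrCA.
Qed.

Lemma timing_integral_setU (A B : set R) h : A `|` B `<=` `[0, +oo[ ->
  measurable A -> measurable B -> measurable_fun (A `|` B) h ->
  [disjoint A & B] -> (forall s, (A `|` B) s -> 0 <= h s) ->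
  TI (A `|` B) h = (TI A h + TI B h)%E.
Proof.
move=> AB0 mA mB mh dAB h0; rewrite /timing_integral ge0_integral_setU//; last 2 first.
- apply/measurable_EFinP; apply: measurable_funM => //; apply: dens_measurableS => //.
  exact: measurableU.
- move=> s Ds; rewrite lee_fin mulr_ge0 ?h0//.
  by apply: dens_ge0; exact/ge0_itvP/AB0.
rewrite (esumID A); last by move=> s Ds; rewrite lee_fin mulr_ge0 ?h0// atom_ge0.
rewrite (_ : (A `|` B) `&` A = A); last exact: setIidr (@subsetUl _ A B).
rewrite (_ : (A `|` B) `&` ~` A = B); last first.
  rewrite setIUl setICr set0U; apply/setIidPl => x Bx Ax.
  by move/disj_setPS: dAB => /(_ x); apply.
by rewrite addeACA.
Qed.

Lemma timing_integral_split s t h : 0 <= s -> s <= t ->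
  measurable_fun `[0, t] h -> (forall r, 0 <= r -> r <= t -> 0 <= h r) ->
  TI `[0, t] h = (TI `[0%R, s] h + TI `]s, t] h)%E.
Proof.
move=> s0 st mh h0.
have E : `[0, t]%classic = `[0, s]%classic `|` `]s, t]%classic :> set R.
  by apply: itv_bndbnd_setU; rewrite bnd_simp.
have sub : `[0, s]%classic `|` `]s, t]%classic `<=` (`[0, +oo[ : set R).
  by rewrite -E => r /=; rewrite !in_itv/= andbT => /andP[].
rewrite E timing_integral_setU//; first by rewrite -E.
  by apply/disj_setPS => r [/=]; rewrite !in_itv/= => /andP[_ rs] /andP[]; rewrite ltNge rs.
by move=> r; rewrite -E /= in_itv/= => /andP[]; exact: h0.
Qed.

Lemma cdf_of_timing_integral t : 0 <= t -> (cdf t)%:E = TI `[0, t] (cst 1).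
Proof.
move=> t0; rewrite cdf_of_law law_decomposition// /timing_integral; congr (_ + _)%E.
  by apply: eq_integral => s _; rewrite mulr1.
apply: eq_esum => s _; rewrite mulr1 fineK//; apply: law_fin.
exact: emeasurable_set1.
Qed.

Lemma cdf_of_incr s t : 0 <= s -> s <= t ->
  (cdf t - cdf s)%:E = TI `]s, t] (cst 1).
Proof.
move=> s0 st; rewrite EFinB (cdf_of_timing_integral (le_trans s0 st)).
rewrite (timing_integral_split s0 st)//.
by rewrite -cdf_of_timing_integral// addeAC subee// add0e.
Qed.

Lemma itv_oc_ge0 s t : 0 <= s -> `]s, t] `<=` (`[0, +oo[ : set R).
Proof.
by move=> s0 r /=; rewrite !in_itv/= andbT => /andP[/ltW + _]; exact: le_trans.
Qed.

Lemma itv_cc_ge0 t : `[0, t] `<=` (`[0, +oo[ : set R).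
Proof. by move=> r /=; rewrite !in_itv/= andbT => /andP[]. Qed.

Lemma cdf_of_nondecreasing s t : 0 <= s -> s <= t -> cdf s <= cdf t.
Proof.
move=> s0 st; rewrite -subr_ge0 -lee_fin cdf_of_incr//.
by apply: timing_integral_ge0 => //; exact: itv_oc_ge0.
Qed.

Lemma cdf_of_ge0 t : 0 <= cdf t.
Proof. by rewrite fine_ge0. Qed.

Lemma cdf_of_le1 t : cdf t <= 1.
Proof. by rewrite -lee_fin cdf_of_law; apply: probability_le1; exact: measurable_ereal_le. Qed.

Lemma timing_integral_incr_le s t h c : 0 <= s -> s <= t -> 0 <= c ->
  measurable_fun `]s, t] h -> (forall r, s < r -> r <= t -> 0 <= h r <= c) ->
  (TI `]s, t] h <= (c * (cdf t - cdf s))%:E)%E.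
Proof.
move=> s0 st c0 mh hc; rewrite EFinM cdf_of_incr// -timing_integralZl//; last first.
  exact: itv_oc_ge0.
apply: le_timing_integral => //; [exact: itv_oc_ge0|exact: measurable_funM|].
by move=> r /=; rewrite in_itv/= mulr1 => /andP[]; exact: hc.
Qed.

Lemma timing_integral_incr_ge s t h c : 0 <= s -> s <= t -> 0 <= c ->
  measurable_fun `]s, t] h -> (forall r, s < r -> r <= t -> c <= h r) ->
  ((c * (cdf t - cdf s))%:E <= TI `]s, t] h)%E.
Proof.
move=> s0 st c0 mh hc; rewrite EFinM cdf_of_incr// -timing_integralZl//; last first.
  exact: itv_oc_ge0.
apply: le_timing_integral => //; [exact: itv_oc_ge0|exact: measurable_funM|].
by move=> r /=; rewrite in_itv/= mulr1 c0 => /andP[]; exact: hc.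
Qed.

Lemma uncharged_dens s : 0 <= s -> ~ charged F s%:E -> dens F s = 0.
Proof.
move=> s0 ch; apply/eqP; rewrite eq_le dens_ge0// andbT leNgt.
by apply/negP => d0; apply: ch; right; exists s.
Qed.

Lemma uncharged_law (x : \bar R) : ~ charged F x -> law F [set x] = 0%E.
Proof.
move=> ch; apply/eqP; rewrite eq_le measure_ge0 andbT leNgt.
by apply/negP => d0; apply: ch; left.
Qed.

Lemma uncharged_timing_integral (D : set R) h : D `<=` `[0, +oo[ ->
  (forall s, D s -> ~ charged F s%:E) -> TI D h = 0%E.
Proof.
move=> D0 ch; rewrite /timing_integral integral0_eq ?add0e ?esum1// => s Ds.
  by rewrite uncharged_law ?mul0r//; exact: ch.
by rewrite uncharged_dens ?mul0r//; [exact/ge0_itvP/D0|exact: ch].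
Qed.

Lemma uncharged_cdf_eq s t : 0 <= s -> s <= t ->
  (forall r, s < r -> r <= t -> ~ charged F r%:E) -> cdf t = cdf s.
Proof.
move=> s0 st ch; apply/eqP; rewrite -subr_eq0; apply/eqP; apply: EFin_inj.
rewrite cdf_of_incr// uncharged_timing_integral//; first exact: itv_oc_ge0.
by move=> r /=; rewrite in_itv/= => /andP[]; exact: ch.
Qed.

Lemma uncharged_cdf_eq0 t : 0 <= t ->
  (forall r, 0 <= r -> r <= t -> ~ charged F r%:E) -> cdf t = 0.
Proof.
move=> t0 ch; apply: EFin_inj.
rewrite cdf_of_timing_integral// uncharged_timing_integral//; first exact: itv_cc_ge0.
by move=> r /=; rewrite in_itv/= => /andP[]; exact: ch.
Qed.

(** The events that the time is at most [s + n] all have probability [cdf s], and what escapes their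
    union is the point [+oo], itself uncharged. *)
Lemma uncharged_cdf_eq1 s : 0 <= s ->
  (forall x : \bar R, (s%:E < x)%E -> ~ charged F x) -> cdf s = 1.
Proof.
move=> s0 ch.
pose A n := [set x : \bar R | (x <= (s + n%:R)%:E)%E].
have mA n : measurable (A n) by exact: measurable_ereal_le.
have cA : law F (A n) @[n --> \oo] --> law F (\bigcup_n A n).
  apply: nondecreasing_cvg_mu => //; first exact: bigcup_measurable.
  move=> n m nm; apply/subsetPset => x /le_trans; apply.
  by rewrite lee_fin lerD2l ler_nat.
have An n : law F (A n) = (cdf s)%:E.
  rewrite -cdf_of_law (@uncharged_cdf_eq s (s + n%:R))// ?lerDl// => r sr _; exact: ch.
have E : (cdf s)%:E = law F (\bigcup_n A n).
  have cs : law F (A n) @[n --> \oo] --> (cdf s)%:E.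
    by rewrite (funext An); exact: cvg_cst.
  exact: (cvg_unique (@ereal_hausdorff R) cs cA).
(* The point [-oo] lies in every [A n], so only [+oo] can be missed. *)
have U : ~` (\bigcup_n A n) `<=` [set +oo%E].
  move=> x nx /=; case: x nx => // [r|] nx; exfalso; apply: nx.
    exists (Num.truncn `|r - s|).+1 => //=; rewrite /A/= lee_fin -lerBlDl.
    by rewrite (le_trans (ler_norm _))// ltW// truncnS_gt.
  by exists 0%N => //; rewrite /A/= leNye.
have mU : measurable (\bigcup_n A n) by exact: bigcup_measurable.
apply: EFin_inj; rewrite E.
have : law F (~` (\bigcup_n A n)) = 0%E.
  apply/eqP; rewrite eq_le measure_ge0 andbT -(@uncharged_law +oo%E); last first.
    by apply: ch; rewrite ltry.
  by apply: le_measure => //; rewrite inE; [exact: measurableC|exact: emeasurable_set1].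
by rewrite probability_setC// => /eqP; rewrite sube_eq// add0e => /eqP <-.
Qed.

(** Continuity of the law from above along the events that the time is at most [s + 1/(n+1)]. *)
Lemma cdf_of_right_continuous s e : 0 <= s -> 0 < e ->
  exists2 d, 0 < d & forall t, s <= t -> t <= s + d -> cdf t <= cdf s + e.
Proof.
move=> s0 e0.
pose A n := [set x : \bar R | (x <= (s + n.+1%:R^-1)%:E)%E].
have mA n : measurable (A n) by exact: measurable_ereal_le.
have cA : law F (A n) @[n --> \oo] --> law F (\bigcap_n A n).
  apply: nonincreasing_cvg_mu => //.
  - by rewrite ltey_eq law_fin.
  - exact: bigcap_measurable.
  - move=> n m nm; apply/subsetPset => x /le_trans; apply.
    by rewrite lee_fin lerD2l lef_pV2 ?posrE// ler_nat.
have E : \bigcap_n A n = [set x : \bar R | (x <= s%:E)%E].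
  apply/seteqP; split => x /= => [H|xs n _ /=]; last first.
    by rewrite /A/= (le_trans xs)// lee_fin lerDl.
  rewrite leNgt; apply/negP; case: x H => [r|H _|H]; last by rewrite ltNge leNye.
    rewrite lte_fin => H sr.
    have := H (Num.truncn (r - s)^-1) I; rewrite /A/= lee_fin -lerBlDl leNgt => /negP; apply.
    by rewrite invf_plt ?posrE ?subr_gt0// truncnS_gt.
  by have := H 0%N I; rewrite /A/= leNgt ltry.
move: cA; rewrite E -cdf_of_law.
move/fine_cvgP => [_ /cvgrPdist_lt/(_ e e0)[n _ /(_ n (leqnn n))]] /= H.
exists n.+1%:R^-1 => // t st tn.
rewrite -lerBlDl (le_trans _ (ltW H))// distrC (le_trans _ (ler_norm _))// lerB//.
by rewrite -/(cdf _) cdf_of_nondecreasing// (le_trans s0).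
Qed.

Lemma cdf_of_measurable (D : set R) : measurable D -> measurable_fun D cdf.
Proof.
move=> mD; apply: nondecreasing_measurable => // s t st.
rewrite -lee_fin !cdf_of_law; apply: le_measure; rewrite ?inE; do ?exact: measurable_ereal_le.
by move=> x /= /le_trans; apply; rewrite lee_fin.
Qed.

Lemma dens_integrable t : 0 <= t -> leb.-integrable `[0, t] (EFin \o dens F).
Proof.
move=> t0; apply/integrableP; split.
  by apply/measurable_EFinP; apply: dens_measurableS => //; exact: itv_cc_ge0.
rewrite [ltLHS](_ : _ = \int[leb]_(s in `[0%R, t]) (dens F s)%:E)%E; last first.
  apply: eq_integral => s; rewrite inE => /itv_cc_ge0/ge0_itvP s0.
  by rewrite /= ger0_norm// dens_ge0.
have := law_decomposition F t0; rewrite -cdf_of_law => E.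
apply: (@le_lt_trans _ _ (cdf t)%:E); last exact: ltry.
by rewrite E leeDl//; exact: esum_ge0.
Qed.

(** Atoms only add to the right-hand side. *)
Lemma dens_incr_le s t : 0 <= s -> s <= t ->
  \int[leb]_(x in `[0, t]) dens F x - \int[leb]_(x in `[0, s]) dens F x
  <= cdf t - cdf s.
Proof.
move=> s0 st; have di := dens_integrable (le_trans s0 st).
rewrite Rintegral_itvB ?bnd_simp// -lee_fin cdf_of_incr// fineK; last first.
  apply: integrable_fin_num => //; apply: integrableS di => // x /=.
  by rewrite !in_itv/= => /andP[/ltW/(le_trans s0) -> ->].
rewrite /timing_integral [leLHS](_ : _ =
    \int[leb]_(x in `]s, t]) (dens F x * cst 1 x)%:E)%E; last first.
  by apply: eq_integral => x _; rewrite mulr1.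
by rewrite leeDl// esum_ge0// => x _; rewrite lee_fin mulr1 atom_ge0.
Qed.

End Timing.

(** * Integrability on bounded intervals and weighted increments *)

Section HalfLine.
Variable R : realType.
Local Notation leb := (@lebesgue_measure R).
Implicit Types (f m : R -> R) (c s t M : R).

Lemma bounded_integrable f t M : measurable_fun (`[0, +oo[ : set R) f ->
  (forall s, 0 <= s -> `|f s| <= M) -> leb.-integrable `[0, t] (EFin \o f).
Proof.
move=> mf fM; apply: measurable_bounded_integrable => //=.
- have := @lebesgue_measure_itv R `[0, t].
  by rewrite /= lte_fin => ->; case: ifP => _; rewrite -?EFinB ltry.
- by apply: measurable_funS mf; [exact: measurable_itv|exact: itv_cc_ge0].
- exists M; split; first by rewrite num_real.
  move=> x Mx s /= /itv_cc_ge0/ge0_itvP s0; exact: le_trans (fM _ s0) (ltW Mx).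
Qed.

Lemma integrableM_bounded f m t M : measurable_fun (`[0, +oo[ : set R) m ->
  (forall s, 0 <= s -> `|m s| <= M) -> leb.-integrable `[0, t] (EFin \o f) ->
  leb.-integrable `[0, t] (EFin \o (fun s => f s * m s)).
Proof.
move=> mm mM fi.
have mf : measurable_fun `[0, t] f by have /measurable_int/measurable_EFinP := fi.
have Mfi := @integrableZl _ _ _ leb `[0, t] (measurable_itv _) M _ fi.
apply: le_integrable Mfi => //.
  apply/measurable_EFinP; apply: measurable_funM => //.
  by apply: measurable_funS mm; [exact: measurable_itv|exact: itv_cc_ge0].
move=> s /= /itv_cc_ge0/ge0_itvP s0; rewrite lee_fin !normrM mulrC ler_wpM2r//.
exact: le_trans (mM s s0) (ler_norm _).
Qed.

(** The mean value inequality with weight [f]: the function [f * (m - c)] is nonnegative. *)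
Lemma cumul_mul_ge f m c s t : 0 <= s -> s <= t ->
  leb.-integrable `[0, t] (EFin \o f) ->
  leb.-integrable `[0, t] (EFin \o (fun r => f r * m r)) ->
  (forall r, s < r -> r < t -> 0 <= f r) ->
  (forall r, s < r -> r < t -> c <= m r) ->
  c * (\int[leb]_(x in `[0, t]) f x - \int[leb]_(x in `[0, s]) f x) <=
  \int[leb]_(x in `[0, t]) (f x * m x) - \int[leb]_(x in `[0, s]) (f x * m x).
Proof.
move=> s0 st fi fmi f0 mc.
have cfi : leb.-integrable `[0, t] (EFin \o (fun x => c * f x)).
  exact: (@integrableZl _ _ _ leb `[0, t] (measurable_itv _) c _ fi).
have di : leb.-integrable `[0, t] (EFin \o (fun x => f x * m x - c * f x)).
  exact: (@integrableB _ _ _ leb `[0, t] (measurable_itv _) _ _ fmi cfi).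
have : 0 * (t - s) <= \int[leb]_(x in `[0, t]) (f x * m x - c * f x) -
                      \int[leb]_(x in `[0, s]) (f x * m x - c * f x).
  apply: cumul_incr_ge => // r sr rt.
  by rewrite subr_ge0 mulrC ler_wpM2l ?f0 ?mc.
rewrite !RintegralB ?RintegralZl//; do ?exact: integrable_itvS st _.
by rewrite mul0r; lra.
Qed.

Lemma cumul_mul_le f m c s t : 0 <= s -> s <= t ->
  leb.-integrable `[0, t] (EFin \o f) ->
  leb.-integrable `[0, t] (EFin \o (fun r => f r * m r)) ->
  (forall r, s < r -> r < t -> 0 <= f r) ->
  (forall r, s < r -> r < t -> m r <= c) ->
  \int[leb]_(x in `[0, t]) (f x * m x) - \int[leb]_(x in `[0, s]) (f x * m x)
  <= c * (\int[leb]_(x in `[0, t]) f x - \int[leb]_(x in `[0, s]) f x).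
Proof.
move=> s0 st fi fmi f0 mc.
have cfi : leb.-integrable `[0, t] (EFin \o (fun x => c * f x)).
  exact: (@integrableZl _ _ _ leb `[0, t] (measurable_itv _) c _ fi).
have di : leb.-integrable `[0, t] (EFin \o (fun x => c * f x - f x * m x)).
  exact: (@integrableB _ _ _ leb `[0, t] (measurable_itv _) _ _ cfi fmi).
have : 0 * (t - s) <= \int[leb]_(x in `[0, t]) (c * f x - f x * m x) -
                      \int[leb]_(x in `[0, s]) (c * f x - f x * m x).
  apply: cumul_incr_ge => // r sr rt.
  by rewrite subr_ge0 mulrC ler_wpM2r ?f0 ?mc.
rewrite !RintegralB ?RintegralZl//; do ?exact: integrable_itvS st _.
by rewrite mul0r; lra.
Qed.

Lemma Rintegral00 f : \int[leb]_(x in `[0, 0]) f x = 0.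
Proof. by rewrite set_itv1 Rintegral_set1. Qed.

End HalfLine.

(** * Discounting and integration by parts *)

Section Discounting.
Variables (R : realType) (E : game R).
Hypothesis admE : admissible E.
Local Notation leb := (@lebesgue_measure R).
Implicit Types (s t : R).

Definition discount t : R := expR (- (rho E * t)).
Local Notation disc := discount.
Definition discounted_survival t : R := disc t * (1 - G E t).
Local Notation phi := discounted_survival.
(* The density of the measure - d phi. *)
Definition discounted_hazard t : R := disc t * (rho E * (1 - G E t) + g E t).
Local Notation dphi := discounted_hazard.

Lemma rho_ge0 : 0 <= rho E. Proof. by rewrite ltW// rho_gt0. Qed.

Lemma G0 : G E 0 = 0. Proof. exact: Rintegral00. Qed.

Lemma G_lt0 t : t < 0 -> G E t = 0.
Proof. by move=> t0; rewrite /G set_itv_ge ?Rintegral_set0// bnd_simp -ltNge. Qed.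

Lemma g_measurable : measurable_fun (`[0, +oo[ : set R) (g E).
Proof.
apply: subspace_continuous_measurable_fun; first exact: measurable_itv.
exact: g_continuous.
Qed.

Lemma g_integrable t : leb.-integrable `[0, t] (EFin \o g E).
Proof.
apply: (@integrableS _ _ _ leb `[0, +oo[) => //; first exact: itv_cc_ge0.
apply/integrableP; split; first by apply/measurable_EFinP; exact: g_measurable.
rewrite [ltLHS](_ : _ = 1%E); first exact: ltry.
rewrite -(g_total admE); apply: eq_integral => s; rewrite inE => /ge0_itvP s0.
by rewrite /= ger0_norm// g_ge0.
Qed.

Lemma G_incr_ge0 s t : 0 <= s -> s <= t -> G E s <= G E t.
Proof.
move=> s0 st; rewrite -subr_ge0 -(mul0r (t - s)).
apply: cumul_incr_ge => //; first exact: g_integrable.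
by move=> x sx _; rewrite g_ge0// (le_trans s0 (ltW sx)).
Qed.

Lemma G_nondecreasing : {homo G E : s t / s <= t}.
Proof.
move=> s t st; have [s0|s0] := leP 0 s; first exact: G_incr_ge0.
rewrite (G_lt0 s0); have [t0|t0] := leP 0 t; last by rewrite G_lt0.
by rewrite -G0 G_incr_ge0.
Qed.

Lemma G_ge0 t : 0 <= G E t.
Proof.
have [t0|t0] := leP 0 t; last by rewrite G_lt0.
by rewrite -G0 G_nondecreasing.
Qed.

Lemma G_measurable (D : set R) : measurable D -> measurable_fun D (G E).
Proof. by move=> mD; apply: nondecreasing_measurable => //; exact: G_nondecreasing. Qed.

Lemma subG_gt0 t : 0 <= t -> 0 < 1 - G E t.
Proof. by move=> t0; rewrite subr_gt0 G_lt1. Qed.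

Lemma subG_le1 t : 1 - G E t <= 1.
Proof. by rewrite lerBlDr lerDl G_ge0. Qed.

Lemma g_hazard t : 0 <= t -> g E t = hazard E t * (1 - G E t).
Proof. by move=> t0; rewrite /hazard divfK// gt_eqF// subG_gt0. Qed.

(** A nonnegative function that decreases strictly forever cannot reach 0. *)
Lemma hazard_gt0 t : 0 <= t -> 0 < hazard E t.
Proof.
move=> t0; apply: (@le_lt_trans _ _ (hazard E (t + 1))).
  have t1 : 0 <= t + 1 by rewrite addr_ge0.
  by rewrite divr_ge0 ?g_ge0// ltW// subG_gt0.
by apply: hazard_decreasing => //; rewrite ltrDl.
Qed.

Lemma hazard_le s t : 0 <= s -> s <= t -> hazard E t <= hazard E s.
Proof.
move=> s0; rewrite le_eqVlt => /predU1P[->//|st].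
by rewrite ltW// hazard_decreasing.
Qed.

Lemma g_gt0 t : 0 <= t -> 0 < g E t.
Proof. by move=> t0; rewrite g_hazard// mulr_gt0 ?hazard_gt0 ?subG_gt0. Qed.

(** The monotone hazard rate makes the density bounded; this is where the [hazard E 0] in all later
    Lipschitz constants comes from. *)
Lemma g_le t : 0 <= t -> g E t <= hazard E 0.
Proof.
move=> t0; rewrite g_hazard// -[leRHS]mulr1 ler_pM ?subG_le1 ?hazard_le//.
  by rewrite ltW// hazard_gt0.
by rewrite ltW// subG_gt0.
Qed.

Lemma disc_gt0 t : 0 < disc t. Proof. exact: expR_gt0. Qed.

Lemma disc_ge0 t : 0 <= disc t. Proof. exact: expR_ge0. Qed.

Lemma disc_le s t : s <= t -> disc t <= disc s.
Proof. by move=> st; rewrite ler_expR lerN2 ler_wpM2l// rho_ge0. Qed.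

Lemma disc0 : disc 0 = 1. Proof. by rewrite /discount mulr0 oppr0 expR0. Qed.

Lemma disc_le1 t : 0 <= t -> disc t <= 1.
Proof. by move=> t0; rewrite -disc0 disc_le. Qed.

Lemma disc_measurable (D : set R) : measurable D -> measurable_fun D disc.
Proof.
move=> mD; apply: (measurableT_comp (@measurable_expR R)).
by apply: measurableT_comp => //; exact: measurable_funM.
Qed.

(** The tangent inequality of the exponential. It holds for [s] and [t] in either order, so swapping
    them gives the upper bound. *)
Lemma disc_incr_ge s t : disc t * rho E * (t - s) <= disc s - disc t.
Proof.
have : 1 + rho E * (t - s) <= expR (rho E * (t - s)) by exact: expR_ge1Dx.
have -> : disc s = disc t * expR (rho E * (t - s)).
  by rewrite /discount -expRD; congr expR; ring.
move=> H; rewrite -[X in _ <= _ - X]mulr1 -mulrBr -mulrA ler_wpM2l//.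
  exact: disc_ge0.
by rewrite lerBrDl.
Qed.

Lemma disc_incr_le s t : disc s - disc t <= disc s * rho E * (t - s).
Proof. by have := disc_incr_ge t s; lra. Qed.

Lemma phi_gt0 t : 0 <= t -> 0 < phi t.
Proof. by move=> t0; rewrite mulr_gt0 ?disc_gt0 ?subG_gt0. Qed.

Lemma phi0 : phi 0 = 1. Proof. by rewrite /discounted_survival disc0 G0 subr0 mulr1. Qed.

Lemma phi_le s t : 0 <= s -> s <= t -> phi t <= phi s.
Proof.
move=> s0 st; apply: ler_pM; rewrite ?disc_le ?lerB ?G_nondecreasing//.
  exact: disc_ge0.
by rewrite ltW// subG_gt0// (le_trans s0).
Qed.

Lemma phi_le1 t : 0 <= t -> phi t <= 1.
Proof. by move=> t0; rewrite -phi0 phi_le. Qed.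

Lemma phi_measurable (D : set R) : measurable D -> measurable_fun D phi.
Proof.
move=> mD; apply: measurable_funM; first exact: disc_measurable.
by apply: measurable_funB => //; exact: G_measurable.
Qed.

Lemma disc_g_integrable t : leb.-integrable `[0, t] (EFin \o (fun s => disc s * g E s)).
Proof.
apply: (@bounded_integrable _ _ _ (hazard E 0)).
  apply: measurable_funM; first by apply: disc_measurable; exact: measurable_itv.
  exact: g_measurable.
move=> s s0; rewrite ger0_norm ?mulr_ge0 ?g_ge0//; last exact: disc_ge0.
rewrite -[leRHS]mul1r ler_pM ?g_ge0 ?g_le ?disc_le1//.
exact: disc_ge0.
Qed.

Lemma phi_integrable t : leb.-integrable `[0, t] (EFin \o phi).
Proof.
apply: (@bounded_integrable _ _ _ 1); first by apply: phi_measurable; exact: measurable_itv.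
by move=> s s0; rewrite ger0_norm ?phi_le1// ltW// phi_gt0.
Qed.

Lemma cumul_dphi t : \int[leb]_(s in `[0, t]) dphi s =
  rho E * \int[leb]_(s in `[0, t]) phi s + \int[leb]_(s in `[0, t]) (disc s * g E s).
Proof.
rewrite -RintegralZl//; last exact: phi_integrable.
rewrite -RintegralD//; last exact: disc_g_integrable.
  by apply: eq_Rintegral => s _; rewrite /discounted_hazard /discounted_survival; ring.
exact: (@integrableZl _ _ _ leb `[0, t] (measurable_itv _) _ _ (phi_integrable t)).
Qed.

Lemma dphi_integrable t : leb.-integrable `[0, t] (EFin \o dphi).
Proof.
have rp := @integrableZl _ _ _ leb `[0, t] (measurable_itv _) (rho E) _ (phi_integrable t).
have := @integrableD _ _ _ leb `[0, t] (measurable_itv _) _ _ rp (disc_g_integrable t).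
apply: eq_integrable => // s _ /=; rewrite -EFinM -EFinD; congr EFin.
by rewrite /discounted_hazard /discounted_survival; ring.
Qed.

(** The product rule for [disc * (1 - G)], obtained by freezing each factor at the ends of a short
    interval. *)
Lemma phiE t : 0 <= t -> phi t = 1 - \int[leb]_(s in `[0, t]) dphi s.
Proof.
move=> t0; apply/eqP; rewrite eq_sym subr_eq eq_sym; apply/eqP.
pose P s := phi s + \int[leb]_(s in `[0, s]) dphi s.
suff : P t = P 0 by rewrite /P Rintegral00 addr0 phi0.
(* Freezing [phi] costs [rho * (s - r)] times the drop of [phi], freezing [disc] costs
   [rho * (s - r)] times the rise of [G]; [G - phi] collects both. *)
apply: (@cst_of_incr _ P (fun s => G E s - phi s) (rho E)) => //; first exact: rho_ge0.
move=> r s r0 rs st; rewrite /P !cumul_dphi.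
have s0 := le_trans r0 rs.
have h1 : phi s * (s - r) <= _ := cumul_incr_ge r0 rs (phi_integrable s)
  (fun x rx xs => phi_le (le_trans r0 (ltW rx)) (ltW xs)).
have h2 : _ <= phi r * (s - r) := cumul_incr_le r0 rs (phi_integrable s)
  (fun x rx xs => phi_le r0 (ltW rx)).
have fi := g_integrable s.
have fmi : leb.-integrable `[0, s] (EFin \o (fun x => g E x * disc x)).
  by have := disc_g_integrable s; apply: eq_integrable => // x _ /=; rewrite mulrC.
have g0 x : r < x -> x < s -> 0 <= g E x.
  by move=> rx _; rewrite g_ge0// (le_trans r0 (ltW rx)).
have h3 := @cumul_mul_ge R _ _ (disc s) r s r0 rs fi fmi g0
  (fun x rx xs => disc_le (ltW xs)).
have h4 := @cumul_mul_le R _ _ (disc r) r s r0 rs fi fmi g0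
  (fun x rx xs => disc_le (ltW rx)).
have cE z : \int[leb]_(x in `[0, z]) (g E x * disc x) =
            \int[leb]_(x in `[0, z]) (disc x * g E x).
  by apply: eq_Rintegral => x _; rewrite mulrC.
rewrite !cE -!/(G E _) in h3 h4.
have d1 := disc_incr_ge r s; have d2 := disc_incr_le r s.
have rho0 := rho_ge0; have er1 := disc_le1 r0.
have dG : 0 <= G E s - G E r by rewrite subr_ge0 G_nondecreasing.
have Gr := ltW (subG_gt0 r0).
have sr : 0 <= s - r by rewrite subr_ge0.
have e1 : disc s * rho E * (s - r) * (1 - G E r) <= (disc r - disc s) * (1 - G E r).
  by rewrite ler_wpM2r.
have e2 : (disc r - disc s) * (1 - G E r) <= disc r * rho E * (s - r) * (1 - G E r).
  by rewrite ler_wpM2r.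
have e3 : (disc r - disc s) * (G E s - G E r) <= rho E * (s - r) * (G E s - G E r).
  rewrite ler_wpM2r//; apply: le_trans d2 _.
  by rewrite -mulrA -[leRHS]mul1r ler_wpM2r// mulr_ge0.
have e4 : 0 <= disc s * rho E * (s - r) * (G E s - G E r).
  by rewrite !mulr_ge0// disc_ge0.
have h1' : rho E * (phi s * (s - r)) <= rho E * _ := ler_wpM2l rho0 h1.
have h2' : rho E * _ <= rho E * (phi r * (s - r)) := ler_wpM2l rho0 h2.
move: h1' h2' h3 h4.
set Is := \int[leb]_(x in `[0, s]) phi x; set Ir := \int[leb]_(x in `[0, r]) phi x.
set Js := \int[leb]_(x in `[0, s]) (disc x * g E x).
set Jr := \int[leb]_(x in `[0, r]) (disc x * g E x).
move=> h1' h2' h3 h4; rewrite ler_norml; apply/andP; split.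
  by move: h1' h2' h3 h4 e1 e2 e3 e4; rewrite /discounted_survival; lra.
by move: h1' h2' h3 h4 e1 e2 e3 e4; rewrite /discounted_survival; lra.
Qed.

Lemma dphi_ge0 t : 0 <= t -> 0 <= dphi t.
Proof.
move=> t0; rewrite mulr_ge0 ?disc_ge0// addr_ge0 ?g_ge0//.
by rewrite mulr_ge0 ?rho_ge0// ltW// subG_gt0.
Qed.

Lemma phi_lipschitz s t : 0 <= s -> s <= t ->
  phi s - phi t <= (rho E + hazard E 0) * (t - s).
Proof.
move=> s0 st; have t0 := le_trans s0 st; rewrite (phiE s0) (phiE t0).
rewrite (_ : 1 - _ - (1 - _) = \int[leb]_(s in `[0, t]) dphi s -
  \int[leb]_(x in `[0, s]) dphi x); last by ring.
apply: cumul_incr_le => //; first exact: dphi_integrable.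
move=> x sx _; have x0 := le_trans s0 (ltW sx).
rewrite -[leRHS]mul1r ler_pM ?disc_le1 ?disc_ge0//.
  by rewrite addr_ge0 ?g_ge0// mulr_ge0 ?rho_ge0// ltW// subG_gt0.
by rewrite lerD ?g_le// -[leRHS]mulr1 ler_wpM2l ?subG_le1 ?rho_ge0.
Qed.

Section ByParts.
Variable F : timing R.
Local Notation cdf := (cdf_of F).

Lemma cdf_of_norm_le1 s : `|cdf s| <= 1.
Proof. by rewrite ger0_norm; [exact: cdf_of_le1|exact: cdf_of_ge0]. Qed.

Lemma integrable_cdfM f t : leb.-integrable `[0, t] (EFin \o f) ->
  leb.-integrable `[0, t] (EFin \o (fun s => f s * cdf s)).
Proof.
apply: (@integrableM_bounded _ _ _ _ 1) => [|s _]; last exact: cdf_of_norm_le1.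
by apply: cdf_of_measurable; exact: measurable_itv.
Qed.

Lemma timing_integral_phi_fin t : 0 <= t ->
  timing_integral F `[0, t] phi \is a fin_num.
Proof.
move=> t0; rewrite ge0_fin_numE; last first.
  apply: timing_integral_ge0; first exact: itv_cc_ge0.
  by move=> s /= /itv_cc_ge0/ge0_itvP/phi_gt0/ltW.
apply: (@le_lt_trans _ _ (cdf t)%:E); last exact: ltry.
rewrite cdf_of_timing_integral//; apply: le_timing_integral => //.
- exact: itv_cc_ge0.
- exact: phi_measurable.
- by move=> s /= /itv_cc_ge0/ge0_itvP s0; rewrite phi_le1// ltW// phi_gt0.
Qed.

(** Atoms do no harm because [phi] is Lipschitz: over []r, s]] both sides grow by [phi] times the
    increment of the cdf, up to an error that [cst_of_incr] absorbs. There is no boundary term at 0,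
    since the atom there is counted in [cdf 0] as well. *)
Lemma timing_integral_by_parts t : 0 <= t -> timing_integral F `[0, t] phi =
  (phi t * cdf t + \int[leb]_(s in `[0, t]) (dphi s * cdf s))%:E.
Proof.
move=> t0.
pose I s := fine (timing_integral F `[0, s] phi).
have IE s : 0 <= s -> (I s)%:E = timing_integral F `[0, s] phi.
  by move=> s0; rewrite fineK ?timing_integral_phi_fin.
have II r s : 0 <= r -> r <= s ->
    (I s - I r)%:E = timing_integral F `]r, s] phi.
  move=> r0 rs; rewrite EFinB !IE ?(le_trans r0)//.
  rewrite (timing_integral_split F r0 rs); last 2 first.
  - exact: phi_measurable.
  - by move=> x x0 _; rewrite ltW// phi_gt0.
  by rewrite -IE// addeAC subee// add0e.
rewrite -IE//; congr EFin.
pose P s := I s - (phi s * cdf s + \int[leb]_(x in `[0, s]) (dphi x * cdf x)).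
suff : P t = P 0.
  rewrite /P Rintegral00 addr0 phi0 mul1r.
  suff -> : I 0 = cdf 0 by rewrite subrr => /eqP; rewrite subr_eq0 => /eqP.
  apply: EFin_inj; rewrite IE// cdf_of_timing_integral// /timing_integral set_itv1.
  by congr (_ + _)%E; [rewrite !integral_set1|apply: eq_esum => s /= ->; rewrite phi0].
apply: (@cst_of_incr _ P cdf (rho E + hazard E 0)) => //.
  by rewrite addr_ge0 ?rho_ge0// ltW// hazard_gt0.
move=> r s r0 rs st; have s0 := le_trans r0 rs.
have dF : 0 <= cdf s - cdf r by rewrite subr_ge0 cdf_of_nondecreasing.
have mphi : measurable_fun `]r, s] phi by exact: phi_measurable.
have p0 := ltW (phi_gt0 s0).
have I1 : phi s * (cdf s - cdf r) <= I s - I r.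
  rewrite -lee_fin II//; apply: timing_integral_incr_ge => // x rx xs.
  by rewrite phi_le// (le_trans r0 (ltW rx)).
have I2 : I s - I r <= phi r * (cdf s - cdf r).
  rewrite -lee_fin II//; apply: timing_integral_incr_le => //.
    exact: ltW (phi_gt0 r0).
  by move=> x rx xs; rewrite phi_le ?(ltW rx)// ltW// phi_gt0// (le_trans r0 (ltW rx)).
have ki := dphi_integrable s.
have kFi := integrable_cdfM ki.
have k0 x : r < x -> x < s -> 0 <= dphi x.
  by move=> rx _; rewrite dphi_ge0// (le_trans r0 (ltW rx)).
have K1 := @cumul_mul_ge R _ _ (cdf r) r s r0 rs ki kFi k0
  (fun x rx xs => cdf_of_nondecreasing F r0 (ltW rx)).
have K2 := @cumul_mul_le R _ _ (cdf s) r s r0 rs ki kFi k0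
  (fun x rx xs => cdf_of_nondecreasing F (le_trans r0 (ltW rx)) (ltW xs)).
have L := ler_wpM2r dF (phi_lipschitz r0 rs).
have KE : \int[leb]_(x in `[0, s]) dphi x - \int[leb]_(x in `[0, r]) dphi x =
  phi r - phi s by rewrite (phiE s0) (phiE r0); ring.
rewrite KE in K1 K2; rewrite /P.
move: K1 K2; set A := \int[leb]_(x in _) _; set B := \int[leb]_(x in _) _ => K1 K2.
rewrite ler_norml; apply/andP; split; lra.
Qed.

(* d (phi (1 - c F)) = - dphi (1 - c F) - c phi dF, integrated over [0, t]. *)
Lemma survival_by_parts c t : 0 <= t ->
  \int[leb]_(s in `[0, t]) (disc s * g E s * (1 - c * cdf s))
    + c * (phi t * cdf t + \int[leb]_(s in `[0, t]) (dphi s * cdf s))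
    + phi t * (1 - c * cdf t) =
  1 - rho E * \int[leb]_(s in `[0, t]) (phi s * (1 - c * cdf s)).
Proof.
move=> t0.
have splitE f : leb.-integrable `[0, t] (EFin \o f) ->
    \int[leb]_(s in `[0, t]) (f s * (1 - c * cdf s)) =
    \int[leb]_(s in `[0, t]) f s - c * \int[leb]_(s in `[0, t]) (f s * cdf s).
  move=> fi; have fF := integrable_cdfM fi.
  rewrite -RintegralZl// -RintegralB//; last first.
    exact: (@integrableZl _ _ _ leb `[0, t] (measurable_itv _) _ _ fF).
  by apply: eq_Rintegral => s _; ring.
have gi := disc_g_integrable t; have pi := phi_integrable t.
rewrite !splitE//.
have -> : \int[leb]_(s in `[0, t]) (dphi s * cdf s) =
    rho E * \int[leb]_(s in `[0, t]) (phi s * cdf s)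
    + \int[leb]_(s in `[0, t]) (disc s * g E s * cdf s).
  have pF := integrable_cdfM pi; have gF := integrable_cdfM gi.
  rewrite -RintegralZl// -RintegralD//.
    by apply: eq_Rintegral => s _; rewrite /discounted_hazard /discounted_survival; ring.
  exact: (@integrableZl _ _ _ leb `[0, t] (measurable_itv _) _ _ pF).
have := phiE t0; rewrite cumul_dphi => p.
have -> : \int[leb]_(s in `[0, t]) (disc s * g E s) =
  1 - phi t - rho E * \int[leb]_(s in `[0, t]) phi s by rewrite p; ring.
ring.
Qed.

End ByParts.

End Discounting.

(** * Payoffs as real functions of time *)

Section RealPayoffs.
Variables (R : realType) (E : game R).
Variables (a : acceptance R) (FP FA : timing R).
Hypothesis admE : admissible E.
Local Notation leb := (@lebesgue_measure R).
Local Notation phi := (discounted_survival E).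
Local Notation disc := (discount E).
Implicit Types (s t : R).

Lemma theta_gt0 : 0 < theta E. Proof. by case/andP: (theta_bounds admE). Qed.
Lemma theta_lt1 : theta E < 1. Proof. by case/andP: (theta_bounds admE). Qed.
Lemma beta_gt0 : 0 < beta E. Proof. by case/andP: (beta_bounds admE). Qed.
Lemma beta_lt_mu : beta E < mu E. Proof. by case/andP: (mu_bounds admE). Qed.
Lemma mu_lt_theta : mu E < theta E. Proof. by case/andP: (mu_bounds admE). Qed.
Lemma mu_gt0 : 0 < mu E. Proof. exact: lt_trans beta_gt0 beta_lt_mu. Qed.
Lemma mu_lt1 : mu E < 1. Proof. exact: lt_trans mu_lt_theta theta_lt1. Qed.
Lemma beta_lt1 : beta E < 1. Proof. exact: lt_trans beta_lt_mu mu_lt1. Qed.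
Lemma sigma_gt0 : 0 < sigma E. Proof. by case/andP: (sigma_bounds admE). Qed.
Lemma sigma_lt1 : sigma E < 1. Proof. by case/andP: (sigma_bounds admE). Qed.

Lemma accept_ge0 s : 0 <= s -> 0 <= a s.
Proof. by move=> s0; case/andP: (accept_bounds a s0). Qed.
Lemma accept_le1 s : 0 <= s -> a s <= 1.
Proof. by move=> s0; case/andP: (accept_bounds a s0). Qed.

Definition stay s : R := 1 - cdf_of FP s.
(** The probability of no fake by time [s]: the agent is manipulative only with probability
    [sigma E], which keeps this at least [1 - sigma E]. *)
Definition survA s : R := 1 - sigma E * cdf_of FA s.

Lemma stay_ge0 s : 0 <= stay s.
Proof. by rewrite subr_ge0 cdf_of_le1. Qed.

Lemma stay_le1 s : stay s <= 1.
Proof. by rewrite lerBlDr lerDl cdf_of_ge0. Qed.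

Lemma stay_le s t : 0 <= s -> s <= t -> stay t <= stay s.
Proof. by move=> s0 st; rewrite lerB// cdf_of_nondecreasing. Qed.

Lemma survA_ge s : 1 - sigma E <= survA s.
Proof. by rewrite lerB// -[leRHS]mulr1 ler_wpM2l ?cdf_of_le1// ltW// sigma_gt0. Qed.

Lemma survA_gt0 s : 0 < survA s.
Proof. by apply: lt_le_trans (survA_ge s); rewrite subr_gt0 sigma_lt1. Qed.

Lemma survA_le1 s : survA s <= 1.
Proof. by rewrite lerBlDr lerDl mulr_ge0 ?cdf_of_ge0// ltW// sigma_gt0. Qed.

Lemma stay_measurable (D : set R) : measurable D -> measurable_fun D stay.
Proof. by move=> mD; apply: measurable_funB => //; exact: cdf_of_measurable. Qed.

Lemma survA_measurable (D : set R) : measurable D -> measurable_fun D survA.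
Proof.
move=> mD; apply: measurable_funB => //; apply: measurable_funM => //.
exact: cdf_of_measurable.
Qed.

Let m0 : measurable (`[0, +oo[ : set R). Proof. exact: measurable_itv. Qed.

(* J is the agent's payoff from faking at t when that fake is always rejected. *)
Definition dJ s : R :=
  stay s * (disc s * (mu E * (1 - beta E) * (g E s * a s)
                      - rho E * beta E * (1 - G E s))).

Definition J t : R := beta E + \int[leb]_(s in `[0, t]) dJ s.

Definition vA t : R := J t + phi t * stay t * ((mu E - beta E) * a t).

Lemma disc_stay_integrable t :
  leb.-integrable `[0, t] (EFin \o (fun s => disc s * g E s * stay s)).
Proof.
apply: (@integrableM_bounded _ _ _ _ 1) => [|s _|]; first exact: stay_measurable.
  by rewrite ger0_norm ?stay_ge0 ?stay_le1.
exact: disc_g_integrable.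
Qed.

Lemma phi_stay_integrable t :
  leb.-integrable `[0, t] (EFin \o (fun s => phi s * stay s)).
Proof.
apply: (@integrableM_bounded _ _ _ _ 1) => [|s _|]; first exact: stay_measurable.
  by rewrite ger0_norm ?stay_ge0 ?stay_le1.
exact: phi_integrable.
Qed.

Lemma accepted_integrable t :
  leb.-integrable `[0, t] (EFin \o (fun s => disc s * g E s * stay s * a s)).
Proof.
apply: (@integrableM_bounded _ _ _ _ 1) => [|s s0|]; first exact: accept_measurable.
  by rewrite ger0_norm ?accept_ge0 ?accept_le1.
exact: disc_stay_integrable.
Qed.

Let intZ (c : R) t (f : R -> R) : leb.-integrable `[0, t] (EFin \o f) ->
  leb.-integrable `[0, t] (EFin \o (fun s => c * f s)).
Proof. by move=> fi; exact: (@integrableZl _ _ _ leb `[0, t] (measurable_itv _) c _ fi). Qed.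

Let intD t (f h : R -> R) : leb.-integrable `[0, t] (EFin \o f) ->
  leb.-integrable `[0, t] (EFin \o h) ->
  leb.-integrable `[0, t] (EFin \o (fun s => f s + h s)).
Proof. by move=> fi hi; exact: (@integrableD _ _ _ leb `[0, t] (measurable_itv _) _ _ fi hi). Qed.

Lemma dJE s : dJ s = mu E * (1 - beta E) * (disc s * g E s * stay s * a s)
  + (- (rho E * beta E)) * (phi s * stay s).
Proof. by rewrite /dJ /discounted_survival; ring. Qed.

Lemma dJ_integrable t : leb.-integrable `[0, t] (EFin \o dJ).
Proof.
have := intD (intZ (mu E * (1 - beta E)) (accepted_integrable t))
             (intZ (- (rho E * beta E)) (phi_stay_integrable t)).
by apply: eq_integrable => // s _ /=; rewrite dJE.
Qed.

Lemma JE t : J t = beta E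
  + (mu E * (1 - beta E) * \int[leb]_(s in `[0, t]) (disc s * g E s * stay s * a s)
     - rho E * beta E * \int[leb]_(s in `[0, t]) (phi s * stay s)).
Proof.
have ai := intZ (mu E * (1 - beta E)) (accepted_integrable t).
have si := intZ (- (rho E * beta E)) (phi_stay_integrable t).
rewrite /J; under eq_Rintegral do rewrite dJE.
rewrite (RintegralD _ ai si)// !RintegralZl// ?mulNr//.
- exact: phi_stay_integrable.
- exact: accepted_integrable.
Qed.

(** Each way the game can end pays [beta E] at least. By parts with [c = 1], these payments sum to
    [beta E] less interest and less the part still outstanding at [t]; the excess on accepted
    genuine news stays under the integral. *)
Lemma flowAE t : 0 <= t -> flowA E a FP `[0, t] = (J t - phi t * stay t * beta E)%:E.
Proof.
move=> t0; rewrite /flowA.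
have -> : timing_integral FP `[0, t] (fun s => discount E s * ((1 - G E s) * beta E)) =
    ((beta E)%:E * timing_integral FP `[0%R, t] phi)%E.
  rewrite -timing_integralZl//.
  - by congr timing_integral; apply/funext => s; rewrite /discounted_survival; ring.
  - exact: itv_cc_ge0.
  - exact: phi_measurable.
  - exact: ltW beta_gt0.
  - by move=> s /= /itv_cc_ge0/ge0_itvP s0; rewrite ltW// phi_gt0.
rewrite timing_integral_by_parts//.
set h := fun s => beta E * (disc s * g E s * stay s)
  + mu E * (1 - beta E) * (disc s * g E s * stay s * a s).
have bi := intZ (beta E) (disc_stay_integrable t).
have ai := intZ (mu E * (1 - beta E)) (accepted_integrable t).
rewrite [X in (X + _ = _)%E](_ : _ = (\int[leb]_(s in `[0%R, t]) (h s)%:E)%E); last first.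
  by apply: eq_integral => s _; rewrite /h /stay /discount /=; congr EFin; ring.
have hi := intD bi ai.
rewrite -[X in (X + _ = _)%E]fineK ?(integrable_fin_num _ hi)// -/(Rintegral _ _ _).
rewrite -EFinM -EFinD; congr EFin.
rewrite (RintegralD _ bi ai)// !RintegralZl//; last 2 first.
- exact: accepted_integrable.
- exact: disc_stay_integrable.
rewrite JE.
have := survival_by_parts admE FP 1 t0.
have S1 f : \int[leb]_(s in `[0, t]) (f s * (1 - 1 * cdf_of FP s)) =
    \int[leb]_(s in `[0, t]) (f s * stay s).
  by apply: eq_Rintegral => s _; rewrite mul1r.
rewrite !S1 !mul1r -/(stay t).
set A := \int[leb]_(s in _) (disc s * g E s * stay s).
set B := \int[leb]_(s in _) (phi s * stay s).
set C := \int[leb]_(s in _) (disc s * g E s * stay s * a s).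
set D := \int[leb]_(s in _) (_ * cdf_of FP s).
move=> H.
have -> : A = 1 - rho E * B - (phi t * cdf_of FP t + D) - phi t * stay t.
  by rewrite -H; ring.
by ring.
Qed.

Lemma uAE t : 0 <= t -> uA E a FP t%:E = (vA t)%:E.
Proof.
move=> t0; rewrite /uA flowAE// -EFinD; congr EFin.
by rewrite /vA /no_newsA /discounted_survival /discount -/(stay t); ring.
Qed.

(** * The principal's payoff and its drift *)

Hypothesis picA : PICa E a FA.

Lemma atom_rejected s : 0 <= s -> is_atom FA s%:E -> a s = 0.
Proof.
move=> s0 at_s; have [_ _] := picA s0; apply.
by rewrite /mu1 at_s mu_lt_theta.
Qed.

Definition numP s : R := mu E * g E s * survA s + mu E * sigma E * dens FA s * (1 - G E s).
Definition denP s : R := mu E * g E s * survA s + sigma E * dens FA s * (1 - G E s).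

Lemma denP_gt0 s : 0 <= s -> 0 < denP s.
Proof.
move=> s0; rewrite ltr_pwDl// ?mulr_gt0 ?g_gt0 ?survA_gt0 ?mu_gt0//.
by rewrite !mulr_ge0 ?dens_ge0// ltW// ?sigma_gt0 ?subG_gt0.
Qed.

Lemma numP_gt0 s : 0 <= s -> 0 < numP s.
Proof.
move=> s0; rewrite ltr_pwDl// ?mulr_gt0 ?g_gt0 ?survA_gt0 ?mu_gt0//.
by rewrite !mulr_ge0 ?dens_ge0// ltW// ?sigma_gt0 ?subG_gt0 ?mu_gt0.
Qed.

Lemma numP_le s : 0 <= s -> numP s <= denP s.
Proof.
move=> s0; rewrite lerD2l ler_wpM2r ?(ltW (subG_gt0 _ _))// ler_wpM2r ?dens_ge0//.
by rewrite -[leRHS]mul1r ler_wpM2r ?(ltW mu_lt1)// ltW// sigma_gt0.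
Qed.

Lemma mu1E s : ~~ is_atom FA s%:E -> mu1 E FA s = numP s / denP s.
Proof. by rewrite /mu1 => /negbTE ->. Qed.

(** What type-1 news adds to the safe payoff: [type1P] equals [theta E + gainP]. *)
Definition gainP s : R := a s * (mu1 E FA s - theta E).

Lemma gainPE s : 0 <= s -> gainP s = a s * (numP s / denP s) - theta E * a s.
Proof.
move=> s0; rewrite /gainP; have [/(atom_rejected s0) ->|/mu1E ->] := boolP (is_atom FA s%:E).
  by rewrite !mul0r mulr0 subr0.
by ring.
Qed.

Lemma gainP_ge0 s : 0 <= s -> 0 <= gainP s.
Proof.
move=> s0; have [p1 p2 p3] := picA s0; rewrite /gainP.
have [lt|gt|eq] := ltgtP (mu1 E FA s) (theta E).
- by rewrite p3// mul0r.
- by rewrite mulr_ge0 ?accept_ge0// subr_ge0 ltW.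
- by rewrite eq subrr mulr0.
Qed.

Lemma gainP_le1 s : 0 <= s -> gainP s <= 1.
Proof.
move=> s0; rewrite gainPE//; apply: (@le_trans _ _ (1 * 1)); last by rewrite mulr1.
apply: (@le_trans _ _ (a s * (numP s / denP s))).
  by rewrite gerBl mulr_ge0 ?accept_ge0// ltW// theta_gt0.
rewrite ler_pM ?accept_ge0 ?accept_le1//.
  by rewrite divr_ge0// ltW// ?numP_gt0 ?denP_gt0.
by rewrite ler_pdivrMr ?denP_gt0// mul1r numP_le.
Qed.

(** Unless acceptance is certain, [PICa] leaves only rejection or indifference. *)
Lemma gainP_eq0 s : 0 <= s -> a s != 1 -> gainP s = 0.
Proof.
move=> s0 a1; have [p1 p2 p3] := picA s0; rewrite /gainP.
have [lt|gt|eq] := ltgtP (mu1 E FA s) (theta E).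
- by rewrite p3// mul0r.
- by rewrite p1// eqxx in a1.
- by rewrite eq subrr mulr0.
Qed.

(** Where nothing is faked, type-1 news is genuine: the posterior is 1, above [theta E], and [PICa]
    forces acceptance. *)
Lemma not_accepted_charged s : 0 <= s -> a s != 1 -> charged FA s%:E.
Proof.
move=> s0; apply: contra_neqP => ch.
have at_s : ~~ is_atom FA s%:E by apply/negP => at_s; apply: ch; left.
have [p1 _ _] := picA s0; apply: p1.
rewrite mu1E// /numP /denP uncharged_dens// !(mulr0, mul0r, addr0) divff ?theta_lt1//.
by rewrite gt_eqF// !mulr_gt0 ?mu_gt0 ?g_gt0 ?survA_gt0.
Qed.

Lemma posterior_measurable :
  measurable_fun (`[0, +oo[ : set R) (fun s => numP s / denP s).
Proof.
have mden : measurable_fun (`[0, +oo[ : set R) denP.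
  apply: measurable_funD.
    apply: measurable_funM; last exact: survA_measurable.
    by apply: measurable_funM => //; exact: g_measurable.
  apply: measurable_funM.
    by apply: measurable_funM => //; exact: dens_measurable.
  by apply: measurable_funB => //; exact: G_measurable.
have mnum : measurable_fun (`[0, +oo[ : set R) numP.
  apply: measurable_funD.
    apply: measurable_funM; last exact: survA_measurable.
    by apply: measurable_funM => //; exact: g_measurable.
  apply: measurable_funM.
    by apply: measurable_funM => //; exact: dens_measurable.
  by apply: measurable_funB => //; exact: G_measurable.
apply: measurable_funM => //.
(* As [denP] is positive, its inverse is a composition of measurable functions. *)
apply: (@eq_measurable_fun _ _ _ _ _ (fun s => expR (- ln (denP s)))).
  by move=> s; rewrite inE => /ge0_itvP s0; rewrite expRN lnK// posrE denP_gt0.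
apply: (measurableT_comp (@measurable_expR R)).
by apply: measurableT_comp => //; exact: measurableT_comp (@measurable_ln R) _.
Qed.

Lemma gainP_measurable : measurable_fun (`[0, +oo[ : set R) gainP.
Proof.
apply: (@eq_measurable_fun _ _ _ _ _
  (fun s => a s * (numP s / denP s) - theta E * a s)).
  by move=> s; rewrite inE => /ge0_itvP s0; rewrite gainPE.
have ma := accept_measurable a.
apply: measurable_funB; last exact: measurable_funM.
by apply: measurable_funM => //; exact: posterior_measurable.
Qed.

(** Gain on genuine type-1 news, gain on fakes, and interest lost by postponing [theta E]. Atoms of
    [FA] contribute nothing. *)
Definition dvP s : R :=
  mu E * (disc s * g E s * survA s * gainP s)
  + sigma E * (dens FA s * (phi s * gainP s))
  + (- (rho E * theta E)) * (phi s * survA s).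

Definition vP t : R := theta E + \int[leb]_(s in `[0, t]) dvP s.

Lemma disc_survA_integrable t :
  leb.-integrable `[0, t] (EFin \o (fun s => disc s * g E s * survA s)).
Proof.
apply: (@integrableM_bounded _ _ _ _ 1) => [|s _|]; first exact: survA_measurable.
  by rewrite ger0_norm ?survA_le1// ltW// survA_gt0.
exact: disc_g_integrable.
Qed.

Lemma phi_survA_integrable t :
  leb.-integrable `[0, t] (EFin \o (fun s => phi s * survA s)).
Proof.
apply: (@integrableM_bounded _ _ _ _ 1) => [|s _|]; first exact: survA_measurable.
  by rewrite ger0_norm ?survA_le1// ltW// survA_gt0.
exact: phi_integrable.
Qed.

Lemma genuine_gain_integrable t :
  leb.-integrable `[0, t] (EFin \o (fun s => disc s * g E s * survA s * gainP s)).
Proof.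
apply: (@integrableM_bounded _ _ _ _ 1) => [|s s0|]; first exact: gainP_measurable.
  by rewrite ger0_norm ?gainP_ge0 ?gainP_le1.
exact: disc_survA_integrable.
Qed.

Lemma phi_gainP_measurable :
  measurable_fun (`[0, +oo[ : set R) (fun s => phi s * gainP s).
Proof. by apply: measurable_funM; [exact: phi_measurable|exact: gainP_measurable]. Qed.

Lemma faked_gain_integrable t : 0 <= t ->
  leb.-integrable `[0, t] (EFin \o (fun s => dens FA s * (phi s * gainP s))).
Proof.
move=> t0; apply: (@integrableM_bounded _ _ _ _ 1) => [|s s0|].
- exact: phi_gainP_measurable.
- have p0 := ltW (phi_gt0 admE s0); have g0 := gainP_ge0 s0.
  rewrite ger0_norm; last exact: mulr_ge0.
  by rewrite -[leRHS]mulr1 ler_pM ?gainP_le1//; exact: phi_le1.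
- exact: dens_integrable.
Qed.

Lemma dvP_integrable t : 0 <= t -> leb.-integrable `[0, t] (EFin \o dvP).
Proof.
move=> t0; apply: intD; last exact/intZ/phi_survA_integrable.
by apply: intD; apply: intZ; [exact: genuine_gain_integrable|exact: faked_gain_integrable].
Qed.

Lemma vPE t : 0 <= t -> vP t = theta E
  + (mu E * \int[leb]_(s in `[0, t]) (disc s * g E s * survA s * gainP s)
     + sigma E * \int[leb]_(s in `[0, t]) (dens FA s * (phi s * gainP s))
     - rho E * theta E * \int[leb]_(s in `[0, t]) (phi s * survA s)).
Proof.
move=> t0; rewrite /vP.
have gi := intZ (mu E) (genuine_gain_integrable t).
have fi := intZ (sigma E) (faked_gain_integrable t0).
have si := intZ (- (rho E * theta E)) (phi_survA_integrable t).
rewrite (RintegralD _ (intD gi fi) si)// (RintegralD _ gi fi)// !RintegralZl// ?mulNr//.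
- exact: phi_survA_integrable.
- exact: faked_gain_integrable.
- exact: genuine_gain_integrable.
Qed.

(* At an atom of FA the posterior is mu < theta, so the report is rejected and gainP vanishes:
   only the density of FA contributes to the gain. *)
Lemma timing_integral_type1P t : 0 <= t ->
  timing_integral FA `[0, t]
    (fun s => discount E s * (sigma E * (1 - G E s) * type1P E a FA s)) =
  ((sigma E * theta E)%:E * timing_integral FA `[0%R, t] phi +
   (sigma E * \int[leb]_(s in `[0, t]) (dens FA s * (phi s * gainP s)))%:E)%E.
Proof.
move=> t0; have s0 := sigma_gt0; have th0 := theta_gt0.
have fi := intZ (sigma E) (faked_gain_integrable t0).
rewrite -timing_integralZl//; last 4 first.
- exact: itv_cc_ge0.
- exact: phi_measurable.
- by rewrite mulr_ge0 ?ltW.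
- by move=> s /= /itv_cc_ge0/ge0_itvP ?; rewrite ltW// phi_gt0.
rewrite /timing_integral [RHS]addeAC; congr (_ + _)%E; last first.
  apply: eq_esum => s /itv_cc_ge0/ge0_itvP ps; congr EFin.
  have [at_s|] := boolP (is_atom FA s%:E).
    rewrite /type1P (atom_rejected ps at_s) /discounted_survival /discount.
    by congr (_ * _); ring.
  by rewrite /is_atom -leNgt measure_le0 => /eqP ->; rewrite !mul0r.
rewrite -RintegralZl//; last exact: faked_gain_integrable.
rewrite /Rintegral fineK ?(integrable_fin_num _ fi)//.
have di : leb.-integrable `[0, t] (EFin \o (fun s => dens FA s * (sigma E * theta E * phi s))).
  apply: (@integrableM_bounded _ _ _ _ 1) => [|s ps|]; last exact: dens_integrable.
    by apply: measurable_funM => //; exact: phi_measurable.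
  have p1 := phi_le1 admE ps; have p0 := ltW (phi_gt0 admE ps).
  have st0 := mulr_ge0 (ltW s0) (ltW th0).
  rewrite ger0_norm; last exact: mulr_ge0.
  rewrite mulr_ile1// mulr_ile1 ?(ltW sigma_lt1) ?(ltW theta_lt1)//; exact: ltW.
rewrite -(integralD_EFin _ di fi)//; apply: eq_integral => s _.
rewrite -EFinD; congr EFin.
by rewrite /type1P /gainP /discounted_survival /discount; ring.
Qed.

Lemma flowPE t : 0 <= t -> flowP E a FA `[0, t] = (vP t - phi t * survA t * theta E)%:E.
Proof.
move=> t0; rewrite /flowP timing_integral_type1P// timing_integral_by_parts//.
have bi := intZ (theta E) (disc_survA_integrable t).
have gi := intZ (mu E) (genuine_gain_integrable t).
have hi := intD bi gi.
rewrite [X in (X + _ = _)%E](_ : _ = (\int[leb]_(s in `[0%R, t])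
    (theta E * (disc s * g E s * survA s)
     + mu E * (disc s * g E s * survA s * gainP s))%:E)%E); last first.
  by apply: eq_integral => s _; rewrite /type1P /gainP /survA /discount /=; congr EFin; ring.
rewrite -[X in (X + _ = _)%E]fineK ?(integrable_fin_num _ hi)// -/(Rintegral _ _ _).
rewrite -EFinM -!EFinD; congr EFin.
rewrite (RintegralD _ bi gi)// !RintegralZl//; last 2 first.
- exact: genuine_gain_integrable.
- exact: disc_survA_integrable.
rewrite vPE//.
have := survival_by_parts admE FA (sigma E) t0.
rewrite -/(survA t).
set A := \int[leb]_(s in _) (disc s * g E s * _).
set B := \int[leb]_(s in _) (phi s * _).
set C := \int[leb]_(s in _) (_ * cdf_of FA s).
set D := \int[leb]_(s in _) (disc s * g E s * survA s * gainP s).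
set I := \int[leb]_(s in _) (dens FA s * _).
move=> H.
have -> : A = 1 - rho E * B - sigma E * (phi t * cdf_of FA t + C) - phi t * survA t.
  by rewrite -H; ring.
by ring.
Qed.

Lemma uPE t : 0 <= t -> uP E a FA t%:E = (vP t)%:E.
Proof.
move=> t0; rewrite /uP flowPE// -EFinD; congr EFin.
by rewrite /no_newsP /discounted_survival /discount -/(survA t); ring.
Qed.

Lemma dvP_gain s : dvP s = disc s * (gainP s * denP s) - rho E * theta E * (phi s * survA s).
Proof. by rewrite /dvP /denP /discounted_survival; ring. Qed.

(** The origin of [phiP]: it is the hazard rate at which accepted genuine news, worth [1 - theta E]
    more than the safe action, just pays for the interest lost on [theta E]. *)
Lemma survA_phiE s : 0 <= s ->
  disc s * (mu E * (1 - theta E) * g E s * survA s) - rho E * theta E * (phi s * survA s)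
  = phi s * survA s * (mu E * (1 - theta E) * (hazard E s - phiP E)).
Proof.
move=> s0; rewrite /phiP g_hazard// /discounted_survival; field.
by rewrite subr_eq0 !gt_eqF ?theta_lt1 ?mu_gt0.
Qed.

(** Accepting a genuine report gains [1 - theta E]; accepting a fake loses [theta E - mu E] in
    expectation. *)
Lemma gainP_denP s : 0 <= s -> ~~ is_atom FA s%:E -> gainP s * denP s =
  a s * (mu E * (1 - theta E) * g E s * survA s
         - (theta E - mu E) * (sigma E * dens FA s * (1 - G E s))).
Proof.
move=> s0 /mu1E muE; rewrite /gainP muE -mulrA; congr (_ * _).
by rewrite mulrBl divfK ?gt_eqF ?denP_gt0// /numP /denP; ring.
Qed.

Lemma faked_flow_ge0 s : 0 <= s ->
  0 <= (theta E - mu E) * (sigma E * dens FA s * (1 - G E s)).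
Proof.
move=> s0; rewrite !mulr_ge0 ?dens_ge0 ?(ltW sigma_gt0) ?(ltW (subG_gt0 _ s0))//.
by rewrite subr_ge0 ltW// mu_lt_theta.
Qed.

Lemma genuine_flow_ge0 s : 0 <= s -> 0 <= mu E * (1 - theta E) * g E s * survA s.
Proof.
move=> s0; rewrite !mulr_ge0 ?g_ge0 ?(ltW mu_gt0) ?(ltW (survA_gt0 s))//.
by rewrite subr_ge0 ltW// theta_lt1.
Qed.

(** Fakes have negative value and rejection discards part of the genuine gain; the bound is the
    drift without either. *)
Lemma dvP_le s : 0 <= s ->
  dvP s <= phi s * survA s * (mu E * (1 - theta E) * (hazard E s - phiP E)).
Proof.
move=> s0; rewrite -survA_phiE// dvP_gain lerB// ler_wpM2l ?disc_ge0//.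
have [/(atom_rejected s0) a0|/(gainP_denP s0) ->] := boolP (is_atom FA s%:E).
  by rewrite /gainP a0 !mul0r genuine_flow_ge0.
have k0 := faked_flow_ge0 s0; have n0 := genuine_flow_ge0 s0.
have a0 := accept_ge0 s0; have a1 := accept_le1 s0.
rewrite mulrBr lerBlDr.
apply: (@le_trans _ _ (1 * (mu E * (1 - theta E) * g E s * survA s))).
  by rewrite ler_wpM2r.
by rewrite mul1r lerDl mulr_ge0.
Qed.

(** With certain acceptance this is an equality. Otherwise the gain is 0 and the posterior at most
    [theta E], which says exactly that the loss on fakes is no smaller than the genuine gain. *)
Lemma dvP_ge s : 0 <= s -> ~~ is_atom FA s%:E ->
  phi s * survA s * (mu E * (1 - theta E) * (hazard E s - phiP E))
  - (theta E - mu E) * sigma E * (dens FA s * phi s) <= dvP s.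
Proof.
move=> s0 nat_s; rewrite -survA_phiE// dvP_gain addrAC lerB//.
have -> : (theta E - mu E) * sigma E * (dens FA s * phi s) =
    disc s * ((theta E - mu E) * (sigma E * dens FA s * (1 - G E s))).
  by rewrite /discounted_survival; ring.
rewrite -mulrBr ler_wpM2l ?disc_ge0//.
have [a1|a1] := eqVneq (a s) 1; first by rewrite gainP_denP// a1 mul1r.
rewrite gainP_eq0// mul0r.
have mu1_le : mu1 E FA s <= theta E.
  by rewrite leNgt; apply: contra_neqN a1 => lt; have [p1 _ _] := picA s0; exact: p1.
rewrite -subr_ge0; move: mu1_le; rewrite mu1E// ler_pdivrMr ?denP_gt0// -subr_ge0.
by rewrite /numP /denP; lra.
Qed.

Lemma dvP_rejected s : 0 <= s -> a s != 1 -> dvP s = - (rho E * theta E * (phi s * survA s)).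
Proof. by move=> s0 a1; rewrite dvP_gain gainP_eq0// mul0r mulr0 sub0r. Qed.

Lemma rho_theta_gt0 : 0 < rho E * theta E.
Proof. by rewrite mulr_gt0 ?rho_gt0 ?theta_gt0. Qed.

Lemma phi_survA_le1 s : 0 <= s -> 0 <= phi s * survA s <= 1.
Proof.
move=> s0; have p0 := ltW (phi_gt0 admE s0); have u0 := ltW (survA_gt0 s).
by rewrite mulr_ile1 ?phi_le1 ?survA_le1// andbT mulr_ge0.
Qed.

Lemma dvP_lower s : 0 <= s -> - (rho E * theta E) <= dvP s.
Proof.
move=> s0; rewrite dvP_gain -[leLHS]sub0r lerB//.
  exact: mulr_ge0 (disc_ge0 E s) (mulr_ge0 (gainP_ge0 s0) (ltW (denP_gt0 s0))).
by rewrite -[leRHS]mulr1 ler_wpM2l ?(ltW rho_theta_gt0)//; case/andP: (phi_survA_le1 s0).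
Qed.

Lemma dvP_upper s : 0 <= s -> dvP s <= hazard E 0.
Proof.
move=> s0; apply: le_trans (dvP_le s0) _.
have /andP[q0 q1] := phi_survA_le1 s0.
have h0 := ltW (hazard_gt0 admE s0).
have c0 : 0 <= mu E * (1 - theta E) by rewrite mulr_ge0 ?(ltW mu_gt0)// subr_ge0 ltW// theta_lt1.
have c1 : mu E * (1 - theta E) <= 1.
  rewrite mulr_ile1 ?(ltW mu_gt0) ?(ltW mu_lt1)//.
    by rewrite subr_ge0 ltW// theta_lt1.
  by rewrite lerBlDr lerDl ltW// theta_gt0.
have pP : 0 <= phiP E.
  by rewrite divr_ge0 ?(ltW rho_theta_gt0).
apply: (@le_trans _ _ (1 * (1 * hazard E s))); last by rewrite !mul1r hazard_le.
apply: (@le_trans _ _ (phi s * survA s * (mu E * (1 - theta E) * hazard E s))).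
  by rewrite ler_wpM2l// ler_wpM2l// gerBl.
by apply: ler_pM => //; [exact: mulr_ge0|exact: ler_wpM2r].
Qed.

(** The density of [FA] may be unbounded, yet the drift is not: gains are nonnegative, and [dvP_le]
    bounds them independently of the faking rate. *)
Lemma vP_lipschitz s t : 0 <= s -> s <= t ->
  `|vP t - vP s| <= (rho E * theta E + hazard E 0) * (t - s).
Proof.
move=> s0 st; have t0 := le_trans s0 st.
have -> : vP t - vP s = \int[leb]_(x in `[0, t]) dvP x - \int[leb]_(x in `[0, s]) dvP x.
  by rewrite /vP opprD addrACA subrr add0r.
have rt := ltW rho_theta_gt0; have h0 := ltW (hazard_gt0 admE (lexx 0)).
have ts : 0 <= t - s by rewrite subr_ge0.
have lo := @cumul_incr_ge _ dvP (- (rho E * theta E)) s t s0 st (dvP_integrable t0)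
  (fun x sx _ => dvP_lower (le_trans s0 (ltW sx))).
have up := @cumul_incr_le _ dvP (hazard E 0) s t s0 st (dvP_integrable t0)
  (fun x sx _ => dvP_upper (le_trans s0 (ltW sx))).
have r1 := mulr_ge0 rt ts; have r2 := mulr_ge0 h0 ts.
by rewrite ler_norml; apply/andP; split; lra.
Qed.

Lemma vP_incr_le c s t : 0 <= s -> s <= t ->
  (forall x, s < x -> x < t -> dvP x <= c) -> vP t - vP s <= c * (t - s).
Proof.
move=> s0 st H; rewrite /vP opprD addrACA subrr add0r.
by apply: cumul_incr_le => //; apply: dvP_integrable; exact: le_trans st.
Qed.

Lemma vP_decreasing_rejected s t : 0 <= s -> s < t ->
  (forall x, s < x -> x < t -> a x != 1) -> vP t < vP s.
Proof.
move=> s0 st a1; have t0 := le_trans s0 (ltW st).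
(* The rate of loss with [phi] and [survA] replaced by their lower bounds on the interval. *)
pose c := rho E * theta E * (phi t * (1 - sigma E)).
have s1 : 0 < 1 - sigma E by rewrite subr_gt0 sigma_lt1.
have c0 : 0 < c by rewrite !mulr_gt0 ?rho_gt0 ?theta_gt0 ?subG_gt0 ?disc_gt0.
rewrite -subr_lt0; apply: (@le_lt_trans _ _ (- c * (t - s))).
  apply: vP_incr_le => // [|x sx xt]; first exact: ltW.
  have x0 := le_trans s0 (ltW sx).
  rewrite dvP_rejected ?a1// lerN2 ler_wpM2l ?(ltW rho_theta_gt0)//.
  apply: ler_pM (survA_ge x); [exact/ltW/phi_gt0|exact: ltW|].
  by apply: phi_le => //; exact: ltW.
by rewrite mulNr oppr_lt0 mulr_gt0// subr_gt0.
Qed.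

Lemma vP_decreasing_late s t : 0 <= s -> s < t -> hazard E s <= phiP E -> vP t < vP s.
Proof.
move=> s0 st hs; have t0 := le_trans s0 (ltW st).
(* At [s] the hazard may equal [phiP], where the drift bound vanishes; beyond the midpoint it is
   bounded away from 0. *)
pose m := (s + t) / 2.
have sm : s < m by rewrite /m; lra.
have mt : m < t by rewrite /m; lra.
have mp := le_trans s0 (ltW sm).
have hm : hazard E m < phiP E by apply: lt_le_trans hs; exact: hazard_decreasing.
have mt1 : 0 < mu E * (1 - theta E) by rewrite mulr_gt0 ?mu_gt0// subr_gt0 theta_lt1.
have s1 : 0 < 1 - sigma E by rewrite subr_gt0 sigma_lt1.
have neg x : 0 <= x -> hazard E x <= phiP E -> dvP x <= 0.
  move=> x0 hx; apply: le_trans (dvP_le x0) _.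
  case/andP: (phi_survA_le1 x0) => q0 _.
  by rewrite mulr_ge0_le0// mulr_ge0_le0 ?(ltW mt1)// subr_le0.
have d1 : vP m - vP s <= 0 * (m - s).
  apply: vP_incr_le => // [|x sx xm]; first exact: ltW.
  have x0 := le_trans s0 (ltW sx).
  by apply: neg => //; apply: le_trans hs; apply: hazard_le => //; exact: ltW.
pose c := phi t * (1 - sigma E) * (mu E * (1 - theta E) * (phiP E - hazard E m)).
have c0 : 0 < c.
  by rewrite mulr_gt0 ?mulr_gt0 ?subG_gt0 ?disc_gt0 ?mu_gt0// subr_gt0// theta_lt1.
have d2 : vP t - vP m <= - c * (t - m).
  apply: vP_incr_le => // [|x mx xt]; first exact: ltW.
  have x0 := le_trans mp (ltW mx).
  apply: le_trans (dvP_le x0) _.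
  rewrite (_ : _ * (_ * _) = - (phi x * survA x *
    (mu E * (1 - theta E) * (phiP E - hazard E x)))) ?lerN2; last by ring.
  apply: ler_pM.
  - by rewrite mulr_ge0// ltW// phi_gt0.
  - by rewrite mulr_ge0 ?(ltW mt1)// subr_ge0 ltW.
  - apply: ler_pM (survA_ge x); [exact/ltW/phi_gt0|exact: ltW|].
    by apply: phi_le => //; exact: ltW.
  - by rewrite ler_wpM2l ?(ltW mt1)// lerB// hazard_le// ltW.
have : 0 < c * (t - m) by rewrite mulr_gt0// subr_gt0.
by move: d1 d2; lra.
Qed.

(** A constant cdf makes the density of [FA] vanish only almost everywhere, so [dvP] need not be
    positive at every point. Adding back the cost of fakes gives [f], which has a pointwise lower
    bound and an increment no larger than that of [dvP]. *)
Lemma vP_increasing_unfaked s t : 0 <= s -> s < t -> phiP E <= hazard E t ->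
  (forall x, s < x -> x < t -> ~~ is_atom FA x%:E) ->
  cdf_of FA t = cdf_of FA s -> vP s < vP t.
Proof.
move=> s0 st ht nat_ FAst; have t0 := le_trans s0 (ltW st).
(* Only before the midpoint is the hazard bounded away from [phiP], to which it may be equal at
   [t]. *)
pose m := (s + t) / 2.
have sm : s < m by rewrite /m; lra.
have mt : m < t by rewrite /m; lra.
have mp := le_trans s0 (ltW sm).
have hm : phiP E < hazard E m by apply: le_lt_trans ht _; exact: hazard_decreasing.
have mt1 : 0 < mu E * (1 - theta E) by rewrite mulr_gt0 ?mu_gt0// subr_gt0 theta_lt1.
have s1 : 0 < 1 - sigma E by rewrite subr_gt0 sigma_lt1.
pose K := (theta E - mu E) * sigma E.
have K0 : 0 <= K by rewrite mulr_ge0 ?subr_ge0 ?(ltW mu_lt_theta) ?(ltW sigma_gt0).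
pose f x := dvP x + K * (dens FA x * phi x).
have dphi_int : leb.-integrable `[0, t] (EFin \o (fun x => dens FA x * phi x)).
  apply: (@integrableM_bounded _ _ _ _ 1) => [|x x0|]; last exact: dens_integrable.
    exact: phi_measurable.
  by rewrite ger0_norm ?phi_le1// ltW// phi_gt0.
have fi : leb.-integrable `[0, t] (EFin \o f).
  by apply: intD; [exact: dvP_integrable|exact: intZ].
have f_ge x : s < x -> x < t ->
    phi x * survA x * (mu E * (1 - theta E) * (hazard E x - phiP E)) <= f x.
  by move=> sx xt; rewrite -lerBlDr dvP_ge ?nat_// (le_trans s0 (ltW sx)).
have dens0 : \int[leb]_(x in `[0, t]) (dens FA x * phi x) -
             \int[leb]_(x in `[0, s]) (dens FA x * phi x) <= 0.
  have H := dens_incr_le FA s0 (ltW st); rewrite FAst subrr in H.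
  apply: (@le_trans _ _ (1 * (\int[leb]_(x in `[0, t]) dens FA x
                              - \int[leb]_(x in `[0, s]) dens FA x))).
    apply: cumul_mul_le => //; [exact: ltW|exact: dens_integrable| |].
      by move=> x sx _; rewrite dens_ge0// (le_trans s0 (ltW sx)).
    by move=> x sx _; rewrite phi_le1// (le_trans s0 (ltW sx)).
  by rewrite mul1r.
have fE z : 0 <= z -> z <= t -> \int[leb]_(x in `[0, z]) f x =
    \int[leb]_(x in `[0, z]) dvP x + K * \int[leb]_(x in `[0, z]) (dens FA x * phi x).
  move=> z0 zt; have di := integrable_itvS zt dphi_int.
  by rewrite (RintegralD _ (dvP_integrable z0) (intZ K di))// RintegralZl//.
pose c := phi t * (1 - sigma E) * (mu E * (1 - theta E) * (hazard E m - phiP E)).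
have c0 : 0 < c.
  apply: mulr_gt0; first by apply: mulr_gt0 => //; exact: phi_gt0.
  by apply: mulr_gt0 => //; rewrite subr_gt0.
have d1 : c * (m - s) <= \int[leb]_(x in `[0, m]) f x - \int[leb]_(x in `[0, s]) f x.
  apply: cumul_incr_ge => // [||x sx xm]; first exact: ltW.
    exact: integrable_itvS (ltW mt) fi.
  have x0 := le_trans s0 (ltW sx).
  apply: le_trans (f_ge _ sx (lt_trans xm mt)); apply: ler_pM.
  - by apply: mulr_ge0; [exact/ltW/phi_gt0|exact: ltW].
  - by apply: mulr_ge0; [exact: ltW|rewrite subr_ge0 ltW].
  - apply: ler_pM (survA_ge x); [exact/ltW/phi_gt0|exact: ltW|].
    by apply: phi_le => //; apply: ltW; exact: lt_trans mt.
  - by apply: ler_wpM2l; [exact: ltW|rewrite lerB// hazard_le// ltW].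
have d2 : 0 * (t - m) <= \int[leb]_(x in `[0, t]) f x - \int[leb]_(x in `[0, m]) f x.
  apply: cumul_incr_ge => // [|x mx xt]; first exact: ltW.
  have x0 := le_trans mp (ltW mx).
  apply: le_trans (f_ge _ (lt_trans sm mx) xt).
  case/andP: (phi_survA_le1 x0) => q0 _; apply: mulr_ge0 => //.
  apply: mulr_ge0; first exact: ltW.
  by rewrite subr_ge0; apply: le_trans ht _; apply: hazard_le => //; exact: ltW.
have cm : 0 < c * (m - s) by rewrite mulr_gt0// subr_gt0.
have Kd : K * (\int[leb]_(x in `[0, t]) (dens FA x * phi x) -
             \int[leb]_(x in `[0, s]) (dens FA x * phi x)) <= 0.
  by rewrite mulr_ge0_le0.
move: d1 d2 Kd; rewrite (fE s s0 (ltW st)) (fE t t0 (lexx t)) /vP.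
by clear -cm; lra.
Qed.

(* The agent's payoff from faking at t if that fake alone is accepted for sure. *)
Definition acceptedA t : R := J t + phi t * stay t * (mu E - beta E).

Lemma vA_accepted t : a t = 1 -> vA t = acceptedA t.
Proof. by rewrite /vA => ->; rewrite mulr1. Qed.

(** The factor [stay s] is kept because this growth is later compared with the value of an accepted
    fake, also proportional to [stay], at times where [stay] may be arbitrarily small. *)
Lemma J_incr_le s t : 0 <= s -> s <= t -> J t - J s <= hazard E 0 * stay s * (t - s).
Proof.
move=> s0 st; rewrite /J opprD addrACA subrr add0r.
apply: cumul_incr_le => //; first exact: dJ_integrable.
move=> x sx _; have x0 := le_trans s0 (ltW sx).
have h0 := ltW (hazard_gt0 admE (lexx 0)).
rewrite /dJ; apply: (@le_trans _ _ (stay x * (1 * (1 * (hazard E 0 * 1))))); last first.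
  by rewrite !mul1r mulr1 [leLHS]mulrC ler_wpM2l// stay_le// ltW.
apply: ler_wpM2l; first exact: stay_ge0.
apply: (@le_trans _ _ (disc x * (mu E * (1 - beta E) * (g E x * a x)))).
  rewrite ler_wpM2l ?disc_ge0// gerBl !mulr_ge0 ?rho_ge0//.
    exact: ltW beta_gt0.
  exact/ltW/subG_gt0.
have ga := mulr_ge0 (g_ge0 admE x0) (accept_ge0 x0).
have mb0 : 0 <= mu E * (1 - beta E).
  by rewrite mulr_ge0 ?(ltW mu_gt0)// subr_ge0 ltW// beta_lt1.
have mb1 : mu E * (1 - beta E) <= 1.
  rewrite mulr_ile1 ?(ltW mu_gt0) ?(ltW mu_lt1)//.
    by rewrite subr_ge0 ltW// beta_lt1.
  by rewrite lerBlDr lerDl ltW// beta_gt0.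
apply: ler_pM => //; [exact: disc_ge0|exact: mulr_ge0|exact: disc_le1|].
apply: ler_pM => //; apply: ler_pM; rewrite ?g_ge0 ?accept_ge0 ?g_le ?accept_le1//.
Qed.

Lemma J_constant s t : 0 <= s -> s <= t -> stay s = 0 -> J t = J s.
Proof.
move=> s0 st q0; have dJ0 x : s < x -> x < t -> dJ x = 0.
  move=> sx _; have : stay x <= 0 by rewrite -q0 stay_le// ltW.
  by rewrite /dJ => xq; rewrite (_ : stay x = 0) ?mul0r//; apply/eqP; rewrite eq_le xq stay_ge0.
have JE0 : J t - J s = \int[leb]_(x in `[0, t]) dJ x - \int[leb]_(x in `[0, s]) dJ x.
  by rewrite /J opprD addrACA subrr add0r.
have up : J t - J s <= 0 * (t - s).
  rewrite JE0; apply: cumul_incr_le => // [|x sx xt]; first exact: dJ_integrable.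
  by rewrite dJ0.
have lo : 0 * (t - s) <= J t - J s.
  rewrite JE0; apply: cumul_incr_ge => // [|x sx xt]; first exact: dJ_integrable.
  by rewrite dJ0.
by apply/eqP; rewrite -subr_eq0 eq_le -{1}(mul0r (t - s)) up -(mul0r (t - s)).
Qed.

(** The bound on [c] involves the exact drift of [acceptedA] while nobody stops. By waiting the
    agent gains [beta E] if type-0 news comes first and loses interest on [mu E], and [phiA] is the
    hazard rate that balances the two; the last term is genuine news that gets rejected. *)
Lemma acceptedA_incr_ge c s t : 0 <= s -> s <= t -> stay t = stay s ->
  (forall x, s < x -> x < t ->
     c <= stay s * (phi x * (beta E * (1 - mu E) * (hazard E x - phiA E)
                             - mu E * (1 - beta E) * hazard E x * (1 - a x)))) ->
  c * (t - s) <= acceptedA t - acceptedA s.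
Proof.
move=> s0 st qst H; have t0 := le_trans s0 st.
have ki := intZ (- (stay s * (mu E - beta E))) (dphi_integrable admE t).
pose f x := dJ x + (- (stay s * (mu E - beta E))) * discounted_hazard E x.
have fi : leb.-integrable `[0, t] (EFin \o f) by apply: intD => //; exact: dJ_integrable.
have -> : acceptedA t - acceptedA s =
    \int[leb]_(x in `[0, t]) f x - \int[leb]_(x in `[0, s]) f x.
  have kis := intZ (- (stay s * (mu E - beta E))) (dphi_integrable admE s).
  rewrite (RintegralD _ (dJ_integrable t) ki)// (RintegralD _ (dJ_integrable s) kis)//.
  rewrite !RintegralZl//; do ?exact: dphi_integrable.
  by rewrite /acceptedA qst (phiE admE t0) (phiE admE s0) /J; ring.
apply: cumul_incr_ge => // x sx xt; apply: le_trans (H _ sx xt) _.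
have x0 := le_trans s0 (ltW sx).
have qx : stay x = stay s.
  by apply/eqP; rewrite eq_le stay_le ?(ltW sx)//= -qst stay_le// ltW.
rewrite /f /dJ qx /discounted_hazard /phiA /discounted_survival g_hazard// le_eqVlt.
apply/orP; left; apply/eqP; field.
by rewrite subr_eq0 !gt_eqF ?mu_lt1 ?beta_gt0.
Qed.

End RealPayoffs.

(** Applied to [uP] in [payoffP]. The integral of [f] is at most that of its positive part, a
    supremum over simple functions below it, and each of these also lies below [c] on [D]. *)
Lemma le_integral_cst_nonmeasurable d (T : measurableType d) (R : realType)
    (m : {measure set T -> \bar R}) (D : set T) (f : T -> \bar R) (c : \bar R) :
  (0 <= c)%E -> (forall x, D x -> (f x <= c)%E) ->
  (\int[m]_(x in D) f x <= \int[m]_(x in D) c)%E.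
Proof.
move=> c0 fc; rewrite integralE; apply: (@le_trans _ _ (\int[m]_(x in D) f^\+ x)%E).
  by rewrite -[leRHS]adde0 leeD2l// oppe_le0 integral_ge0.
rewrite !ge0_integralE//; apply: ereal_sup_le => _ [h /= hf <-]; exists h => // x.
apply: le_trans (hf x) _; rewrite !patchE; case: ifPn => // /set_mem Dx.
by rewrite funeposE ge_max fc.
Qed.

(** * Flows over the half-line as limits of flows over bounded intervals *)

Section Infinity.
Variable R : realType.
Local Notation leb := (@lebesgue_measure R).
Implicit Types (f h : R -> R) (C : \bar R).

Lemma bigcup_itv_nat : \bigcup_n `[0, n%:R]%classic = `[0, +oo[%classic :> set R.
Proof.
apply/seteqP; split => [x [n _ /itv_cc_ge0]//|x /ge0_itvP x0].
exists (Num.truncn x).+1 => //=; rewrite in_itv/= x0/=.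
by rewrite ltW// truncnS_gt.
Qed.

Lemma itv_nat_homo : {homo (fun n : nat => `[0, n%:R]%classic : set R) :
  n m / (n <= m)%N >-> (n <= m)%O}.
Proof.
move=> n m nm; apply/subsetPset => x /=; rewrite !in_itv/= => /andP[-> /= /le_trans]; apply.
by rewrite ler_nat.
Qed.

Lemma cvg_cumul f : measurable_fun (`[0, +oo[ : set R) f ->
  (forall s, 0 <= s -> 0 <= f s) ->
  (\int[leb]_(s in `[0%R, n%:R]) (f s)%:E)%E @[n --> \oo] -->
  (\int[leb]_(s in `[0%R, +oo[) (f s)%:E)%E.
Proof.
move=> mf f0; rewrite -bigcup_itv_nat; apply: ge0_nondecreasing_set_cvg_integral => //.
- exact: itv_nat_homo.
- move=> n; apply/measurable_EFinP; apply: measurable_funS mf; first exact: measurable_itv.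
  exact: itv_cc_ge0.
- by move=> n x /itv_cc_ge0/ge0_itvP x0; rewrite lee_fin f0.
Qed.

(** The sum is a supremum over finite sets, and every finite set of times lies in some [[0, n]]. *)
Lemma cvg_esum_itv (b : R -> \bar R) : (forall s, 0 <= s -> (0 <= b s)%E) ->
  (\esum_(s in `[0%R, n%:R]) b s)%E @[n --> \oo] --> (\esum_(s in `[0%R, +oo[) b s)%E.
Proof.
move=> b0.
have sub (A B : set R) : A `<=` B -> (\esum_(s in A) b s <= \esum_(s in B) b s)%E.
  move=> AB; apply: ereal_sup_le => _ [X [fX XA] <-]; exists X => //.
  by split => //; exact: subset_trans AB.
rewrite [X in _ --> X](_ : _ = ereal_sup (range (fun n : nat => \esum_(s in `[0%R, n%:R]) b s)%E)).
  apply: ereal_nondecreasing_cvgn => n m nm; apply: sub.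
  exact/subsetPset/itv_nat_homo.
apply/eqP; rewrite eq_le; apply/andP; split; last first.
  by apply: ge_ereal_sup => _ [n _ <-]; apply: sub; exact: itv_cc_ge0.
apply: ge_ereal_sup => _ [X [fX X0] <-].
have [n Xn] : exists n, X `<=` `[0%R, n%:R]%classic.
  have [M XM] : exists M : R, forall x, X x -> x <= M.
    have /finite_seqP[s sX] := fX.
    exists (\sum_(x <- s) `|x|) => x Xx.
    have xs : x \in s by move: Xx; rewrite sX.
    by rewrite (big_rem x)//= (le_trans (ler_norm x))// lerDl sumr_ge0.
  exists (Num.truncn M).+1 => x Xx /=; rewrite in_itv/=.
  have /ge0_itvP -> /= := X0 _ Xx.
  by apply: le_trans (XM _ Xx) _; rewrite ltW// truncnS_gt.
apply: (@le_trans _ _ (\esum_(s in `[0%R, n%:R]) b s)%E).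
  by apply: esum_ge; exists X.
by apply: ereal_sup_ubound; exists n.
Qed.

Lemma flow_oo_le (F : timing R) f h C T :
  measurable_fun (`[0, +oo[ : set R) f -> measurable_fun (`[0, +oo[ : set R) h ->
  (forall s, 0 <= s -> 0 <= f s) -> (forall s, 0 <= s -> 0 <= h s) ->
  (forall t, 0 <= t -> T <= t ->
    (\int[leb]_(s in `[0%R, t]) (f s)%:E + timing_integral F `[0%R, t] h <= C)%E) ->
  (\int[leb]_(s in `[0%R, +oo[) (f s)%:E + timing_integral F `[0%R, +oo[ h <= C)%E.
Proof.
move=> mf mh f0 h0 H.
have d0 s : 0 <= s -> 0 <= dens F s * h s by move=> s0; rewrite mulr_ge0 ?dens_ge0 ?h0.
have l0 s : 0 <= s -> (0 <= (fine (law F [set s%:E]) * h s)%:E)%E.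
  by move=> s0; rewrite lee_fin mulr_ge0 ?atom_ge0 ?h0.
have cf := cvg_cumul mf f0.
have cd : (\int[leb]_(s in `[0%R, n%:R]) (dens F s * h s)%:E)%E @[n --> \oo] -->
    (\int[leb]_(s in `[0%R, +oo[) (dens F s * h s)%:E)%E.
  by apply: cvg_cumul => //; apply: measurable_funM => //; exact: dens_measurable.
have cl := cvg_esum_itv l0.
have D (A : set R) : A `<=` `[0, +oo[ ->
    (\int[leb]_(s in A) (dens F s * h s)%:E +? \esum_(s in A) (fine (law F [set s%:E]) * h s)%:E)%E.
  move=> A0; apply: ge0_adde_def; rewrite inE.
    by apply: integral_ge0 => s /A0/ge0_itvP s0; rewrite lee_fin d0.
  by apply: esum_ge0 => s /A0/ge0_itvP; exact: l0.
have ct : timing_integral F `[0%R, n%:R] h @[n --> \oo] --> timing_integral F `[0%R, +oo[ h.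
  by apply: cvgeD => //; exact: D.
have Df : (\int[leb]_(s in `[0%R, +oo[) (f s)%:E +? timing_integral F `[0%R, +oo[ h)%E.
  apply: ge0_adde_def; rewrite inE.
    by apply: integral_ge0 => s /ge0_itvP s0; rewrite lee_fin f0.
  by apply: timing_integral_ge0 => // s /ge0_itvP; exact: h0.
have c : (\int[leb]_(s in `[0%R, n%:R]) (f s)%:E + timing_integral F `[0%R, n%:R] h)%E
    @[n --> \oo] -->
    (\int[leb]_(s in `[0%R, +oo[) (f s)%:E + timing_integral F `[0%R, +oo[ h)%E.
  exact: cvgeD.
apply: (cvge_to_le c).
near=> n; apply: H => //.
near: n; exists (Num.truncn T).+1 => // n /= Tn.
by rewrite (le_trans (ltW (truncnS_gt T)))// ler_nat.
Unshelve. all: by end_near. Qed.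

End Infinity.

(** * Payoffs from never acting, and the meaning of beneficial search *)

Section PayoffBounds.
Variables (R : realType) (E : game R).
Variables (a : acceptance R) (FP FA : timing R).
Hypothesis admE : admissible E.
Hypothesis picA : PICa E a FA.
Local Notation leb := (@lebesgue_measure R).
Implicit Types (s t C T : R).

Let m0 : measurable (`[0, +oo[ : set R). Proof. exact: measurable_itv. Qed.

(** The flow up to [t] is [J t] less a nonnegative amount still outstanding, so an eventual bound on
    [J] passes to the limit. *)
Lemma uA_oo_le C T : (forall t, 0 <= t -> T <= t -> J E a FP t <= C) ->
  (uA E a FP +oo <= C%:E)%E.
Proof.
move=> H; apply: (@flow_oo_le _ _ _ _ _ T).
- have mQ := stay_measurable FP m0.
  have mg := g_measurable admE; have ma := accept_measurable a.
  apply: measurable_funM; first exact: disc_measurable.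
  apply: measurable_funD.
    by apply: measurable_funM => //; apply: measurable_funM => //; exact: measurable_funM.
  apply: measurable_funM; first by apply: measurable_funM => //; exact: measurable_funM.
  by apply: measurable_funD => //; apply: measurable_funM => //; exact: measurable_funB.
- apply: measurable_funM; first exact: disc_measurable.
  by apply: measurable_funM => //; apply: measurable_funB => //; exact: G_measurable.
- move=> s s0; have q0 := stay_ge0 FP s; have g0 := g_ge0 admE s0.
  have a0 := accept_ge0 a s0; have a1 := accept_le1 a s0.
  have b0 := ltW (beta_gt0 admE); have u0 := ltW (mu_gt0 admE).
  apply: mulr_ge0; first exact: expR_ge0.
  apply: addr_ge0; first by rewrite !mulr_ge0// subr_ge0 ltW// mu_lt1.
  by rewrite !mulr_ge0// addr_ge0// mulr_ge0// subr_ge0.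
- move=> s s0; apply: mulr_ge0; first exact: expR_ge0.
  by rewrite mulr_ge0// ltW// ?subG_gt0// beta_gt0.
move=> t t0 Tt; rewrite -/(flowA E a FP `[0%R, t]) flowAE// lee_fin.
apply: le_trans (H _ t0 Tt); rewrite gerBl !mulr_ge0 ?(ltW (beta_gt0 admE)) ?stay_ge0//.
  exact: disc_ge0.
exact/ltW/subG_gt0.
Qed.

Lemma type1PE s : type1P E a FA s = theta E + gainP E a FA s.
Proof. by rewrite /type1P /gainP; ring. Qed.

Lemma uP_oo_le C T : (forall t, 0 <= t -> T <= t -> vP E a FA t <= C) ->
  (uP E a FA +oo <= C%:E)%E.
Proof.
move=> H.
have mS := survA_measurable E FA m0.
have mg := g_measurable admE; have mG := G_measurable admE m0.
have mt : measurable_fun (`[0, +oo[ : set R) (type1P E a FA).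
  rewrite (funext type1PE); apply: measurable_funD => //; exact: gainP_measurable.
have t0 s : 0 <= s -> 0 <= type1P E a FA s.
  by move=> s0; rewrite type1PE addr_ge0 ?(gainP_ge0 picA)// ltW// theta_gt0.
apply: (@flow_oo_le _ _ _ _ _ T).
- apply: measurable_funM; first exact: disc_measurable.
  apply: measurable_funD.
    by apply: measurable_funM => //; apply: measurable_funM => //; exact: measurable_funM.
  by apply: measurable_funM => //; apply: measurable_funM => //; exact: measurable_funM.
- apply: measurable_funM; first exact: disc_measurable.
  by apply: measurable_funM => //; apply: measurable_funM => //; exact: measurable_funB.
- move=> s s0; have S0 := ltW (survA_gt0 FA admE s); have g0 := g_ge0 admE s0.
  have th0 := ltW (theta_gt0 admE); have u0 := ltW (mu_gt0 admE).
  apply: mulr_ge0; first exact: expR_ge0.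
  apply: addr_ge0; first by rewrite !mulr_ge0// subr_ge0 ltW// mu_lt1.
  by rewrite !mulr_ge0// t0.
- move=> s s0; apply: mulr_ge0; first exact: expR_ge0.
  by rewrite !mulr_ge0 ?t0 ?(ltW (subG_gt0 admE s0))// ltW// sigma_gt0.
move=> t tp Tt; rewrite -/(flowP E a FA `[0%R, t]) flowPE// lee_fin.
apply: le_trans (H _ tp Tt); rewrite gerBl !mulr_ge0 ?(ltW (theta_gt0 admE))//.
- exact: disc_ge0.
- exact/ltW/subG_gt0.
- exact/ltW/survA_gt0.
Qed.

Lemma beneficial_search_ex : beneficial_search E a FP FA ->
  exists2 x : \bar R, (0 <= x)%E & ((theta E)%:E < uP E a FA x)%E.
Proof.
move=> ben; apply: contrapT => nex; move: ben; apply/negP; rewrite -leNgt /payoffP.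
apply: le_trans (@le_integral_cst_nonmeasurable _ _ _ _ _ _ (theta E)%:E _ _) _.
- by rewrite lee_fin ltW// theta_gt0.
- move=> x /= x0; rewrite leNgt; apply/negP => lt; apply: nex; by exists x.
have mD : measurable [set x : \bar R | (0 <= x)%E].
  rewrite (_ : [set x | _] = `[0%E, +oo[%classic); first exact: emeasurable_itv.
  by apply/seteqP; split => x /=; rewrite in_itv/= andbT.
by rewrite integral_cst// [X in (_ * X)%E](_ : _ = 1%E) ?mule1//; exact: law_ge0.
Qed.

End PayoffBounds.

(** Such a set is the image of an open set of reals, together with at most the two infinite
    points. *)
Lemma open_emeasurable (R : realType) (U : set (\bar R)) : open U -> measurable U.
Proof.
move=> oU; pose V := [set y : R | U y%:E].
have oV : open V.
  by rewrite openE => y Vy; exact: (open_nbhs_nbhs (conj oU Vy)).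
have mU1 (x : \bar R) : measurable (U `&` [set x]).
  have [Ux|Ux] := pselect (U x).
    rewrite (_ : _ `&` _ = [set x]); first exact: emeasurable_set1.
    by apply/setIidr => _ ->.
  rewrite (_ : _ `&` _ = set0)//.
  by apply/seteqP; split => // y [Uy yx]; apply: Ux; rewrite -yx.
have -> : U = EFin @` V `|` (U `&` [set -oo%E] `|` U `&` [set +oo%E]).
  apply/seteqP; split => [[y||] Uy|y [[z Vz <-]|[[]|[]]]]//.
  - by left; exists y.
  - by right; right.
  - by right; left.
apply: measurableU; last exact: measurableU.
by apply: measurable_image_EFin; exact: open_measurable.
Qed.

(** * First times, atoms and supports read off the cdf *)

Section TimingSupport.
Variables (R : realType) (F : timing R).
Local Notation cdf := (cdf_of F).
Implicit Types (r s t : R).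

(** Right-continuity makes the infimum of the times at which the cdf has reached [cdf t] one of
    them. *)
Lemma cdf_of_first_time t : 0 <= t -> exists s,
  [/\ 0 <= s, s <= t, cdf s = cdf t & forall r, 0 <= r -> r < s -> cdf r < cdf t].
Proof.
move=> t0; pose S := [set r | 0 <= r /\ cdf t <= cdf r].
have St : S t by split.
have lbS : lbound S 0 by move=> r [].
have hS : has_inf S by split; [exists t|exists 0].
have s0 : 0 <= inf S by apply: lb_le_inf => //; exists t.
have st : inf S <= t by apply: ge_inf => //; exists 0.
exists (inf S); split => //.
  apply/eqP; rewrite eq_le cdf_of_nondecreasing//=; apply/ler_addgt0Pr => e e0.
  have [d d0 H] := cdf_of_right_continuous F s0 e0.
  have [r [r0 tr] rd] := inf_adherent d0 hS.
  apply: (le_trans tr); apply: H (ltW rd).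
  by apply: ge_inf; [exists 0|split].
move=> r r0 rs; rewrite ltNge; apply/negP => tr.
by move: rs; rewrite ltNge => /negP; apply; apply: ge_inf; [exists 0|split].
Qed.

Lemma cdf_of_atom_le s t : s < t -> cdf s + fine (law F [set t%:E]) <= cdf t.
Proof.
move=> st; have mt := @emeasurable_set1 R t%:E.
rewrite -lee_fin EFinD !cdf_of_law fineK; last exact: law_fin.
have ms := measurable_ereal_le s%:E.
have dst : [set x : \bar R | (x <= s%:E)%E] `&` [set t%:E] = set0.
  apply/seteqP; split => // x [/= + xt]; rewrite xt lee_fin => ts.
  by move: st; rewrite ltNge ts.
rewrite -(measureU _ ms mt dst); apply: le_measure; rewrite ?inE.
- exact: measurableU.
- exact: measurable_ereal_le.
- by move=> x [/= /le_trans|/= ->//]; apply; rewrite lee_fin ltW.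
Qed.

Lemma ex_charged : exists2 x : \bar R, (0 <= x)%E & charged F x.
Proof.
apply: contrapT => nex.
have nch x : (0 <= x)%E -> ~ charged F x by move=> x0 cx; apply: nex; exists x.
have c1 : cdf 0 = 1 by apply: uncharged_cdf_eq1 => // x /ltW; exact: nch.
have c0 : cdf 0 = 0.
  by apply: uncharged_cdf_eq0 => // r r0 _; apply: nch; rewrite lee_fin.
by move/eqP: c1; rewrite c0 eq_sym oner_eq0.
Qed.

Lemma support_of_itv (l u : R) : 0 < l -> l < u ->
  (forall t, 0 <= t -> t < l -> cdf t = 0) -> cdf u = 1 ->
  (forall s t, l <= s -> s < t -> t <= u -> cdf s < cdf t) ->
  support_of F = [set x | (l%:E <= x <= u%:E)%E].
Proof.
move=> l0 lu c0 c1 cinc.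
have mgt (z : R) : measurable [set y : \bar R | (z%:E < y)%E].
  rewrite (_ : [set y | _] = ~` [set y : \bar R | (y <= z%:E)%E]).
    by apply: measurableC; exact: measurable_ereal_le.
  by apply/seteqP; split => y /=; rewrite ltNge => /negP.
have mlt (z : R) : measurable [set y : \bar R | (y < z%:E)%E].
  rewrite (_ : [set y | _] = `]-oo, z%:E[%classic); first exact: emeasurable_itv.
  by apply/seteqP; split => y /=; rewrite in_itv.
have law0 (z : R) : 0 <= z -> z < l -> law F [set y : \bar R | (y < z%:E)%E] = 0%E.
  move=> z0 zl; apply/eqP; rewrite eq_le measure_ge0 andbT.
  have <- : (cdf z)%:E = 0%E by rewrite c0.
  rewrite cdf_of_law; apply: le_measure; rewrite ?inE//; first exact: measurable_ereal_le.
  by move=> y /=; exact: ltW.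
have lawu : law F [set y : \bar R | (u%:E < y)%E] = 0%E.
  rewrite (_ : [set y | _] = ~` [set y : \bar R | (y <= u%:E)%E]); last first.
    by apply/seteqP; split => y /=; rewrite ltNge => /negP.
  have := cdf_of_law F u; rewrite c1 => law_u.
  rewrite (probability_setC _ (measurable_ereal_le _)).
  by rewrite [X in (_ - X)%E](_ : _ = 1%E) ?subee.
apply/seteqP; split => x /= => [H|/andP[lx xu] U oU Ux].
  apply/andP; split; rewrite leNgt; apply/negP => lt.
    have [z z0 [zl xz]] : exists2 z : R, 0 <= z & z < l /\ (x < z%:E)%E.
      case: x lt {H} => [r||]; rewrite ?lte_fin.
      - move=> rl; exists (Num.max 0 ((r + l) / 2)); first by rewrite le_max lexx.
        by rewrite gt_max l0 lte_fin lt_max; split; [|apply/orP; right]; lra.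
      - by rewrite ltNge leey.
      - by move=> _; exists 0 => //; rewrite ltNyr.
    have := H _ (@open_ereal_lt_ereal R z%:E) xz; rewrite law0// ltxx//.
  by have := H _ (@open_ereal_gt_ereal R u%:E) lt; rewrite lawu ltxx.
case: x lx xu Ux => [r||//]; rewrite ?lee_fin => lr ru Ur; last by [].
have /nbhs_ballP[e /= e0 eU] : nbhs r (fun y : R => U y%:E) by exact: (open_nbhs_nbhs (conj oU Ur)).
(* Clipping a half-size neighbourhood of [r] to [[l, u]] leaves a nondegenerate interval inside [U],
   on which the cdf increases. *)
pose s := Num.max l (r - e / 2); pose t := Num.min u (r + e / 2).
have ls : l <= s by rewrite le_max lexx.
have tu : t <= u by rewrite ge_min lexx.
have st : s < t.
  by rewrite gt_max !lt_min lu; apply/andP; split; apply/andP; split; lra.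
have mst : measurable [set y : \bar R | (s%:E < y <= t%:E)%E].
  rewrite (_ : [set y | _] = `]s%:E, t%:E]%classic); first exact: emeasurable_itv.
  by apply/seteqP; split => y /=; rewrite in_itv.
have s0 : 0 <= s by rewrite (le_trans (ltW l0)).
have pos : (0 < law F [set y : \bar R | (s%:E < y <= t%:E)%E])%E.
  have E : [set y : \bar R | (y <= t%:E)%E] =
    [set y : \bar R | (y <= s%:E)%E] `|` [set y : \bar R | (s%:E < y <= t%:E)%E].
    apply/seteqP; split => y /= => [yt|[ys|/andP[]//]].
      by have [ys|sy] := leP y s%:E; [left|right; rewrite yt].
    by rewrite (le_trans ys)// lee_fin ltW.
  have : (law F [set y : \bar R | (y <= s%:E)%E] < law F [set y : \bar R | (y <= t%:E)%E])%E.
    by rewrite -!cdf_of_law lte_fin cinc.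
  have dst : [set y : \bar R | (y <= s%:E)%E] `&`
      [set y : \bar R | (s%:E < y <= t%:E)%E] = set0.
    by apply/seteqP; split => // y [/= ys /andP[sy _]]; move: sy; rewrite ltNge ys.
  rewrite E (measureU _ (measurable_ereal_le _) mst dst).
  by rewrite -[ltLHS]adde0 lteD2lE//; apply: law_fin; exact: measurable_ereal_le.
apply: lt_le_trans pos _; apply: le_measure; rewrite ?inE//.
  exact: open_emeasurable.
case=> [y||]; rewrite /= ?lte_fin ?lee_fin.
- move=> /andP[sy yt]; apply: eU; rewrite /ball/= ltr_norml; move: sy yt.
  rewrite gt_max le_min => /andP[_ ?] /andP[_ ?]; apply/andP; split; lra.
- by move=> /andP[_]; rewrite leNgt ltry.
- by [].
Qed.

End TimingSupport.

(** * Equilibrium analysis *)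

Section Equilibrium.
Variables (R : realType) (E : game R) (tauP : R).
Variables (a : acceptance R) (FP FA : timing R).
Hypothesis admE : admissible E.
Hypothesis A2 : phiA E < phiP E.
Hypothesis tauP_gt0 : 0 < tauP.
Hypothesis tauP_def : hazard E tauP = phiP E.
Hypothesis aic : AIC E a FP FA.
Hypothesis picA : PICa E a FA.
Hypothesis picT : PICt E a FP FA.
Hypothesis ben : beneficial_search E a FP FA.
Implicit Types (r s t : R).
Local Notation v := (vP E a FA).
Local Notation w := (vA E a FP).
Local Notation aA := (acceptedA E a FP).
Local Notation q := (stay FP).
Local Notation phi := (discounted_survival E).
Local Notation L := (rho E * theta E + hazard E 0).

Let h0_gt0 : 0 < hazard E 0. Proof. exact: hazard_gt0. Qed.
Let L_gt0 : 0 < L. Proof. by rewrite addr_gt0 ?rho_theta_gt0. Qed.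
Let mub_gt0 : 0 < mu E - beta E. Proof. by rewrite subr_gt0 beta_lt_mu. Qed.

(** * When the principal can stop and the agent can fake *)

Lemma vP_late s t : tauP <= s -> s < t -> v t < v s.
Proof.
move=> ts st; have s0 := le_trans (ltW tauP_gt0) ts.
by apply: vP_decreasing_late => //; rewrite -tauP_def hazard_le// ltW.
Qed.

Lemma charged_principal (x : \bar R) : (0 <= x)%E -> charged FP x ->
  exists t, [/\ x = t%:E, 0 <= t, t <= tauP, theta E < v t &
    forall t', 0 <= t' -> v t' <= v t].
Proof.
move=> x0 cx; have tp := ltW tauP_gt0.
have IC t : 0 <= t -> ((v t)%:E <= uP E a FA x)%E.
  by move=> t0; rewrite -uPE//; apply: picT => //; rewrite lee_fin.
have [t [xt t0 tt]] : exists t, [/\ x = t%:E, 0 <= t & t <= tauP].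
  case: x x0 cx IC => [t||//] x0 cx IC.
    rewrite lee_fin in x0; exists t; split => //; rewrite leNgt; apply/negP => lt.
    have := IC _ tp; rewrite uPE// lee_fin leNgt => /negP; apply.
    exact: vP_late.
  (* Never stopping is compared with [tauP + 1], which is already strictly worse than [tauP]. *)
  exfalso; have : (uP E a FA +oo <= (v (tauP + 1))%:E)%E.
    apply: (@uP_oo_le _ _ _ _ admE picA _ (tauP + 1)) => t t0.
    rewrite le_eqVlt => /predU1P[->//|lt].
    by apply/ltW/vP_late; rewrite ?lerDl.
  have lt : v (tauP + 1) < v tauP by apply: vP_late; rewrite ?ltrDl.
  by rewrite leNgt => /negP; apply; apply: lt_le_trans (IC _ tp); rewrite lte_fin.
subst x; exists t; split => //; last first.
  by move=> t' t'0; have := IC _ t'0; rewrite uPE// lee_fin.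
have [y y0 yb] := beneficial_search_ex admE ben.
by rewrite -lte_fin -(uPE admE picA)//; apply: lt_le_trans yb _; exact: picT.
Qed.

Lemma vP0 : v 0 = theta E.
Proof. by rewrite /vP Rintegral00 addr0. Qed.

Lemma stop_optimal t t' : 0 <= t -> 0 <= t' -> charged FP t%:E -> v t' <= v t.
Proof.
move=> t0 t'0 ct; have t0E : (0 <= t%:E)%E by rewrite lee_fin.
by have [_ [[<-] _ _ _]] := charged_principal t0E ct; exact.
Qed.

Lemma cdfP_tauP t : tauP <= t -> cdf_of FP t = 1.
Proof.
move=> tt; apply/eqP; rewrite eq_le cdf_of_le1/=.
rewrite -(@uncharged_cdf_eq1 _ FP tauP (ltW tauP_gt0)).
  by rewrite cdf_of_nondecreasing// ltW.
move=> x tx cx; have x0 : (0 <= x)%E by rewrite (le_trans _ (ltW tx))// lee_fin ltW.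
have [s [xs _ st _ _]] := charged_principal x0 cx.
by move: tx; rewrite xs lte_fin ltNge st.
Qed.

(** Beneficial search makes the optimum exceed [theta E], the value of stopping at once, and a
    Lipschitz payoff needs time to climb that far. *)
Lemma stop_after_delay : exists2 e, 0 < e & cdf_of FP e = 0.
Proof.
have [x x0 cx] := ex_charged FP.
have [t [_ t0 _ tht opt]] := charged_principal x0 cx.
(* Half the time needed at slope [L], so that the optimum is still strictly out of reach. *)
exists ((v t - theta E) / (2 * L)).
  by rewrite divr_gt0 ?subr_gt0 ?mulr_gt0.
set e := (_ / _); have e0 : 0 <= e by rewrite divr_ge0 ?subr_ge0 ?mulr_ge0 ?ltW.
apply: uncharged_cdf_eq0 => // r r0 re cr.
have := stop_optimal r0 t0 cr; rewrite leNgt => /negP; apply.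
have := vP_lipschitz admE picA (lexx 0) r0; rewrite vP0 subr0 => H.
have H1 : v r - theta E <= L * r := le_trans (ler_norm _) H.
have H2 : L * r <= L * e by rewrite ler_wpM2l// ltW.
have H3 : L * e = (v t - theta E) / 2.
  by rewrite /e; field; exact: lt0r_neq0.
by lra.
Qed.

(* Times charged by FP are optimal, and the payoff is Lipschitz, so limits of such times are
   optimal too. *)
Lemma stop_limit_optimal t t' : 0 < t -> 0 <= t' ->
  (forall s, 0 <= s -> s < t -> cdf_of FP s < cdf_of FP t) -> v t' <= v t.
Proof.
move=> t0 t'0 H; rewrite leNgt; apply/negP => lt.
(* At slope [L] the payoff cannot fall from the optimum to [v t] in less than [d], yet a charged
   time lies within [d] of [t]. *)
pose d := (v t' - v t) / L.
have d0 : 0 < d by rewrite divr_gt0 ?subr_gt0.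
pose s := Num.max 0 (t - d).
have s0 : 0 <= s by rewrite le_max lexx.
have st : s < t by rewrite gt_max t0 gtrBl.
have [r [sr rt cr]] : exists r, [/\ s < r, r <= t & charged FP r%:E].
  apply: contrapT => nex; have := H s s0 st.
  rewrite (@uncharged_cdf_eq _ FP s t s0 (ltW st)) ?ltxx// => r sr rt cr.
  by apply: nex; exists r.
have r0 := le_trans s0 (ltW sr).
have := vP_lipschitz admE picA r0 rt; rewrite distrC => /(le_trans (ler_norm _)) lip.
have opt := stop_optimal r0 t'0 cr.
have tr : t - r < d.
  by move: sr; rewrite gt_max => /andP[_]; rewrite ltrBlDr addrC -ltrBlDr.
have Ld : L * d = v t' - v t by rewrite mulrC divfK// gt_eqF.
have : L * (t - r) < L * d by rewrite ltr_pM2l.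
by lra.
Qed.

Lemma cdfP_0 : cdf_of FP 0 = 0.
Proof.
have [e e0 eF] := stop_after_delay.
apply/eqP; rewrite eq_le cdf_of_ge0 andbT -[leRHS]eF.
exact: cdf_of_nondecreasing (ltW e0).
Qed.

Lemma vA_after s t : 0 <= s -> s <= t -> cdf_of FP s = 1 -> w t = J E a FP s.
Proof.
move=> s0 st F1; have q0 : q s = 0 by rewrite /stay F1 subrr.
have qt : q t = 0 by apply/eqP; rewrite eq_le stay_ge0 -q0 stay_le.
by rewrite /vA qt mulr0 mul0r addr0 (J_constant a admE s0 st q0).
Qed.

(* Some fake just before T is accepted, and it beats every fake after T. *)
Lemma no_fake_after T : 0 < T -> cdf_of FP T = 1 ->
  (forall s, 0 <= s -> s < T -> cdf_of FP s < 1) ->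
  forall x : \bar R, (T%:E <= x)%E -> ~ charged FA x.
Proof.
move=> T0 F1 FT x Tx cx.
(* Within [e] of [T] the growth of [J] cannot make up for the extra [mu E - beta E] of an accepted
   fake; both carry the same factor [q t], which cancels. *)
pose e := phi T * (mu E - beta E) / hazard E 0.
have pT : 0 < phi T by apply: phi_gt0 => //; exact: ltW.
have e0 : 0 < e by rewrite divr_gt0 ?h0_gt0// mulr_gt0.
pose s := Num.max 0 (T - e).
have s0 : 0 <= s by rewrite le_max lexx.
have sT : s < T by rewrite gt_max T0 gtrBl.
(* Without certain acceptance somewhere in []s, T[] the principal would lose by waiting from [s] to
   [T], but [T] is optimal as a limit of stopping times. *)
have [t [st tT at1]] : exists t, [/\ s < t, t < T & a t = 1].
  apply: contrapT => nex.
  have : v T < v s.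
    apply: vP_decreasing_rejected => // r sr rT; apply/eqP => ar.
    by apply: nex; exists r.
  rewrite ltNge => /negP; apply; apply: stop_limit_optimal => // r r0 rT.
  by rewrite F1; exact: FT.
have t0 := le_trans s0 (ltW st).
have lt : J E a FP T < w t.
  rewrite (vA_accepted E FP at1) /acceptedA -ltrBlDl.
  apply: le_lt_trans (J_incr_le a FP admE t0 (ltW tT)) _.
  have qt : 0 < q t by rewrite subr_gt0 FT.
  rewrite mulrAC [ltRHS]mulrAC ltr_pM2r//.
  have te : T - t < e.
    by move: st; rewrite gt_max => /andP[_]; rewrite ltrBlDr addrC -ltrBlDr.
  apply: (@lt_le_trans _ _ (hazard E 0 * e)); first by rewrite ltr_pM2l ?h0_gt0.
  rewrite /e mulrC divfK ?gt_eqF ?h0_gt0//.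
  by rewrite ler_wpM2r ?(ltW mub_gt0)// phi_le// ltW.
have Tp := ltW T0.
have x0 : (0 <= x)%E by rewrite (le_trans _ Tx)// lee_fin.
have IC : ((w t)%:E <= uA E a FP x)%E.
  by rewrite -uAE//; apply: aic => //; rewrite lee_fin.
have : (uA E a FP x <= (J E a FP T)%:E)%E.
  case: x Tx {cx x0 IC} => [r||//].
    rewrite lee_fin => Tr; rewrite uAE ?(le_trans Tp)//.
    by rewrite (vA_after Tp Tr F1).
  move=> _; apply: (@uA_oo_le _ _ _ _ admE _ T) => r r0 Tr.
  rewrite (J_constant a admE Tp Tr)//.
  by rewrite /stay F1 subrr.
by move=> /(le_trans IC); rewrite lee_fin leNgt lt.
Qed.

(** Were stopping certain by some [T < tauP], nobody would fake after [T], and waiting until [tauP]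
    would beat the optimal time [T]. *)
Lemma cdfP_lt1 t : 0 <= t -> t < tauP -> cdf_of FP t < 1.
Proof.
have tp := ltW tauP_gt0.
have [T [T0 Tt FT H]] := cdf_of_first_time FP tp.
rewrite (cdfP_tauP (lexx tauP)) in FT H.
suff TE : T = tauP by rewrite -TE; exact: H.
apply/eqP; rewrite eq_le Tt leNgt; apply/negP => lt.
have Tpos : 0 < T.
  rewrite lt_neqAle T0 andbT; apply/negP => /eqP T00.
  by move/eqP: FT; rewrite -T00 cdfP_0 eq_sym oner_eq0.
have nf := no_fake_after Tpos FT H.
have : v tauP <= v T by apply: stop_limit_optimal => // s s0 sT; rewrite FT H.
rewrite leNgt => /negP; apply; apply: vP_increasing_unfaked => //.
- by rewrite tauP_def.
- move=> x Tx _; apply/negP => at_x; apply: (nf x%:E); last by left.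
  by rewrite lee_fin ltW.
- by apply: uncharged_cdf_eq => // r Tr _; apply: nf; rewrite lee_fin ltW.
Qed.

Lemma no_late_fake (x : \bar R) : (tauP%:E <= x)%E -> ~ charged FA x.
Proof. by apply: no_fake_after => //; [exact: cdfP_tauP|exact: cdfP_lt1]. Qed.

Lemma fake_early (x : \bar R) : (0 <= x)%E -> charged FA x ->
  exists t, [/\ x = t%:E, 0 <= t, t < tauP & forall t', 0 <= t' -> w t' <= w t].
Proof.
move=> x0 cx.
have lt : (x < tauP%:E)%E by rewrite ltNge; apply/negP => /no_late_fake; exact.
case: x x0 cx lt => [t||]//; rewrite lee_fin lte_fin => t0 ct tt.
exists t; split => // t' t'0; rewrite -lee_fin -!uAE//.
by apply: aic => //; rewrite lee_fin.
Qed.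

(** [J] falls at rate at most [rho E * beta E], [phi] is Lipschitz and [stay] is right-continuous.
    From the left an atom of [FP] may cause a jump. *)
Lemma acceptedA_right_lsc s e : 0 <= s -> 0 < e -> exists2 d, 0 < d &
  forall t, s <= t -> t <= s + d -> aA s - e <= aA t.
Proof.
move=> s0 e0.
have rb0 : 0 < rho E * beta E by rewrite mulr_gt0 ?rho_gt0 ?beta_gt0.
pose C := rho E + hazard E 0.
have C0 : 0 < C by rewrite addr_gt0 ?rho_gt0.
have [d1 d10 H1] := cdf_of_right_continuous FP s0 (divr_gt0 e0 (ltr0Sn _ 2)).
pose d := Num.min d1 (e / 3 / (C + rho E * beta E)).
have Cr0 : 0 < C + rho E * beta E by rewrite addr_gt0.
have d0 : 0 < d by rewrite lt_min d10 !divr_gt0.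
exists d => // t st td; have t0 := le_trans s0 st.
have Q : q s - q t <= e / 3.
  have : cdf_of FP t <= cdf_of FP s + e / 3.
    by apply: H1 => //; apply: le_trans td _; rewrite lerD2l ge_min lexx.
  by rewrite /stay; lra.
have P := phi_lipschitz admE s0 st.
have Jl : - (rho E * beta E) * (t - s) <= J E a FP t - J E a FP s.
  rewrite /J opprD addrACA subrr add0r.
  apply: cumul_incr_ge => // [|x sx _]; first exact: dJ_integrable.
  have x0 := le_trans s0 (ltW sx).
  have p01 : 0 <= q x * phi x <= 1.
    have ph := ltW (phi_gt0 admE x0); have qx := stay_ge0 FP x.
    by rewrite mulr_ge0// mulr_ile1// ?stay_le1// phi_le1.
  case/andP: p01 => p0 p1.
  have : 0 <= q x * (discount E x * (mu E * (1 - beta E) * (g E x * a x))).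
    have := mu_gt0 admE; have := beta_lt1 admE => b1 m1.
    rewrite mulr_ge0 ?stay_ge0// mulr_ge0 ?disc_ge0// mulr_ge0//.
      by rewrite mulr_ge0 ?(ltW m1)// subr_ge0 ltW.
    by rewrite mulr_ge0 ?g_ge0 ?accept_ge0.
  have : rho E * beta E * (q x * phi x) <= rho E * beta E.
    by rewrite -[leRHS]mulr1 ler_wpM2l// ltW.
  by rewrite /dJ /discounted_survival; lra.
have dt : (C + rho E * beta E) * (t - s) <= e / 3.
  rewrite mulrC -ler_pdivlMr//; apply: (@le_trans _ _ d); first by rewrite lerBlDl.
  by rewrite ge_min lexx orbT.
have ts : 0 <= t - s by rewrite subr_ge0.
have pq : phi s * q s - phi t * q t <= (q s - q t) + (phi s - phi t).
  have ps : phi s <= 1 by exact: phi_le1.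
  have qt : q t <= 1 by exact: stay_le1.
  have A0 : (q s - q t) * phi s <= q s - q t.
    by rewrite -[leRHS]mulr1 ler_wpM2l// subr_ge0 stay_le.
  have B0 : (phi s - phi t) * q t <= phi s - phi t.
    by rewrite -[leRHS]mulr1 ler_wpM2l// subr_ge0 phi_le.
  by lra.
have qps : 0 <= phi s * q s - phi t * q t.
  rewrite subr_ge0; apply: ler_pM; rewrite ?stay_ge0 ?stay_le ?phi_le//.
  exact/ltW/phi_gt0.
have mb1 : mu E - beta E <= 1.
  by have := mu_lt1 admE; have := beta_gt0 admE; lra.
have fin : (phi s * q s - phi t * q t) * (mu E - beta E) <= (q s - q t) + (phi s - phi t).
  by apply: le_trans pq; rewrite -[leRHS]mulr1 ler_wpM2l.
by move: fin P Jl dt Q ts; rewrite /acceptedA -/C; lra.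
Qed.

(* While fakes are rejected with positive probability, the agent's payoff from an
   accepted fake stays above his value; it returns to it only where fakes are accepted
   for sure, and it is increasing just before. *)
Lemma always_accepted t : 0 <= t -> a t = 1.
Proof.
move=> t00; apply/eqP; rewrite -[_ == _]negbK; apply/negP => at0.
rename t into t0.
have rejected s : 0 <= s -> a s != 1 -> s < tauP /\ forall t, 0 <= t -> w t <= w s.
  move=> s0 as1; have cs := not_accepted_charged admE picA s0 as1.
  have s0E : (0 <= s%:E)%E by rewrite lee_fin.
  by have [_ [[<-] _ sl opt]] := fake_early s0E cs.
have [t0tau opt0] := rejected _ t00 at0.
pose M := w t0.
have wM s : 0 <= s -> a s != 1 -> w s = M.
  move=> s0 as1; have [_ opts] := rejected _ s0 as1.
  by apply/eqP; rewrite eq_le opt0//= opts.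
(* The stretch from [t0] on which no fake is accepted for sure. Its right end [t1] may or may not
   belong to it. *)
pose X := [set t | t0 <= t /\ forall s, t0 <= s -> s <= t -> a s != 1].
have Xt0 : X t0.
  split => // s s1 s2; suff -> : s = t0 by [].
  by apply/eqP; rewrite eq_le s1 s2.
have Xub : ubound X tauP.
  move=> t [tt H]; have [lt _] := rejected t (le_trans t00 tt) (H t tt (lexx t)).
  exact: ltW.
have hX : has_sup X by split; [exists t0|exists tauP].
pose t1 := sup X.
have t01 : t0 <= t1 by apply: ub_le_sup => //; exists tauP.
have t1tau : t1 <= tauP by apply: ge_sup => //; exists t0.
have t10 := le_trans t00 t01.
have a_lt s : t0 <= s -> s < t1 -> a s != 1.
  move=> s1 s2; have e0 : 0 < t1 - s by rewrite subr_gt0.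
  have [t [tt H] lt] := sup_adherent e0 hX.
  by apply: H => //; move: lt; rewrite subKr => /ltW.
(* A stop at [t1] itself is excluded too: the loss accrues over the open interval before it. *)
have Fconst : cdf_of FP t1 = cdf_of FP t0.
  apply: uncharged_cdf_eq => // r r1 r2 cr.
  have r0 := le_trans t00 (ltW r1).
  have : v t0 <= v r by exact: stop_optimal.
  rewrite leNgt => /negP; apply; apply: vP_decreasing_rejected => // x x1 x2.
  by apply: a_lt; [exact: ltW|exact: lt_le_trans r2].
have F0 := cdfP_lt1 t00 t0tau.
have t1lt : t1 < tauP.
  rewrite lt_neqAle t1tau andbT; apply/negP => /eqP E1.
  by move: F0; rewrite -Fconst E1 cdfP_tauP// ltxx.
have qq : q t1 = q t0 by rewrite /stay Fconst.
have qpos : 0 < q t0 by rewrite subr_gt0.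
have above s : 0 <= s -> a s != 1 -> 0 < q s ->
    aA s = M + phi s * q s * ((mu E - beta E) * (1 - a s)) /\ M < aA s.
  move=> s0 as1 qs; have := wM s s0 as1.
  have pos : 0 < phi s * q s * ((mu E - beta E) * (1 - a s)).
    rewrite !mulr_gt0 ?disc_gt0 ?subG_gt0// subr_gt0 lt_neqAle as1.
    exact: accept_le1.
  have : aA s = w s + phi s * q s * ((mu E - beta E) * (1 - a s)).
    by rewrite /acceptedA /vA; ring.
  by move=> -> ->; split => //; rewrite ltrDl.
(* If [t1] belongs to the stretch, [acceptedA] exceeds [M] there and, by semicontinuity, shortly
   afterwards; certain acceptance would then beat the optimum [M], so the stretch would go on past
   its supremum. *)
have [a1|a1] := eqVneq (a t1) 1; last first.
  have q1 : 0 < q t1 by rewrite qq.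
  have [_ Mlt] := above t1 t10 a1 q1.
  have e0 : 0 < (aA t1 - M) / 2 by rewrite divr_gt0 ?subr_gt0.
  have [d d0 H] := acceptedA_right_lsc t10 e0.
  have : X (t1 + d).
    split; first by rewrite (le_trans t01)// lerDl ltW.
    move=> s s1 s2; have [lt|le] := ltP s t1; first exact: a_lt.
    apply/negP => /eqP as1; have s0 := le_trans t10 le.
    have := opt0 s s0; rewrite (vA_accepted E FP as1) -/M.
    by have := H s le s2; lra.
  move=> /(ub_le_sup (ex_intro _ tauP Xub)); rewrite -/t1 leNgt => /negP; apply.
  by rewrite ltrDl.
have aM : aA t1 <= M by rewrite -(vA_accepted E FP a1) opt0.
have lt01 : t0 < t1.
  rewrite lt_neqAle t01 andbT; apply/negP => /eqP E1.
  by move: at0; rewrite E1 a1 eqxx.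
pose B := beta E * (1 - mu E); pose m := mu E * (1 - beta E).
have b0 := beta_gt0 admE; have u1 := mu_lt1 admE; have u0 := mu_gt0 admE.
have bl1 := beta_lt1 admE.
have B0 : 0 < B by rewrite mulr_gt0// subr_gt0.
have m0 : 0 < m by rewrite mulr_gt0// subr_gt0.
have BphiA : B * phiA E = rho E * mu E.
  by rewrite /phiA mulrC divfK// gt_eqF.
have rmu : 0 < rho E * mu E by rewrite mulr_gt0 ?rho_gt0.
(* Bounds the rate at which [acceptedA] can fall on the stretch. *)
pose c := rho E * mu E + m * hazard E 0.
have c0 : 0 < c by rewrite addr_gt0// mulr_gt0.
have rise r x : t0 <= r -> r < x -> x < t1 ->
   q r * (phi x * (beta E * (1 - mu E) * (hazard E x - phiA E)
      - mu E * (1 - beta E) * hazard E x * (1 - a x))) =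
   q t0 * (phi x * (B * hazard E x - rho E * mu E - m * hazard E x * (1 - a x))).
  move=> r1 r2 r3; rewrite -BphiA /B /m.
  have -> : q r = q t0; last by ring.
  apply/eqP; rewrite eq_le stay_le//= -qq stay_le ?(le_trans t00)// ltW//.
  exact: lt_trans r2 r3.
have lip r : t0 <= r -> r <= t1 -> aA r - aA t1 <= c * (t1 - r).
  move=> r1 r2; have r0 := le_trans t00 r1.
  have qr : q t1 = q r.
    by apply/eqP; rewrite eq_le stay_le//= qq stay_le.
  have := @acceptedA_incr_ge _ E a FP admE (- c) r t1 r0 r2 qr.
  move=> H; rewrite -lerN2 opprB -mulNr; apply: H => x x1 x2; rewrite rise//.
  have x0 := le_trans r0 (ltW x1).
  have p1 : q t0 * phi x <= 1.
    by rewrite mulr_ile1 ?stay_ge0 ?stay_le1 ?phi_le1// ltW// phi_gt0.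
  have p0 : 0 <= q t0 * phi x by rewrite mulr_ge0 ?stay_ge0// ltW// phi_gt0.
  have hx := ltW (hazard_gt0 admE x0).
  have h1 : hazard E x <= hazard E 0 by exact: hazard_le.
  have Bh : 0 <= B * hazard E x by rewrite mulr_ge0// ltW.
  have ax0 := accept_ge0 a x0; have ax1 := accept_le1 a x0.
  have mh : m * hazard E x * (1 - a x) <= m * hazard E 0.
    rewrite -mulrA ler_wpM2l ?(ltW m0)//; apply: le_trans h1.
    by rewrite -[leRHS]mulr1 ler_wpM2l// gerBl.
  have br : - c <= B * hazard E x - rho E * mu E - m * hazard E x * (1 - a x).
    by rewrite /c; lra.
  rewrite mulrA; apply: (@le_trans _ _ (q t0 * phi x * - c)); last by rewrite ler_wpM2l.
  by rewrite mulrN lerN2 -[leRHS]mul1r ler_wpM2r// ltW.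
(* This is [B * (phiP E - phiA E)]: up to the factor [q * phi], the drift that (A2) guarantees
   before [tauP] when fakes are surely accepted. *)
pose delta := B * phiP E - rho E * mu E.
have dl0 : 0 < delta by rewrite /delta -BphiA -mulrBr mulr_gt0// subr_gt0.
pose K := phi t1 * q t0 * (mu E - beta E).
have K0 : 0 < K by rewrite !mulr_gt0 ?disc_gt0 ?subG_gt0.
(* Chosen so that within [eta] of [t1] the inequality [K * (1 - a x) <= c * (t1 - x)] keeps the
   rejection term of the drift at most [delta]. *)
pose eta := delta * K / (m * hazard E 0 * c).
have eta0 : 0 < eta.
  exact: divr_gt0 (mulr_gt0 dl0 K0) (mulr_gt0 (mulr_gt0 m0 h0_gt0) c0).
pose s := Num.max t0 (t1 - eta).
have s1 : t0 <= s by rewrite le_max lexx.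
have s2 : s < t1 by rewrite gt_max lt01 gtrBl.
have s0 := le_trans t00 s1.
have qs : q t1 = q s.
  by apply/eqP; rewrite eq_le stay_le ?(ltW s2)//= qq stay_le.
have : 0 * (t1 - s) <= aA t1 - aA s.
  apply: (@acceptedA_incr_ge _ E a FP admE 0 s t1 s0 (ltW s2) qs) => x x1 x2.
  have x3 := le_trans s1 (ltW x1); have x0 := le_trans t00 x3.
  rewrite rise//; apply: mulr_ge0; first exact: ltW.
  apply: mulr_ge0; first exact/ltW/phi_gt0.
  have qx : q x = q t0.
    by apply/eqP; rewrite eq_le stay_le//= -qq stay_le// ltW.
  have qxp : 0 < q x by rewrite qx.
  have [aE _] := above x x0 (a_lt _ x3 x2) qxp.
  have ax1 := accept_le1 a x0.
  (* Indifference puts [acceptedA] above [M] by a multiple of [1 - a x], and it must come down to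
     [M] by [t1] at rate at most [c]: acceptance is nearly certain just before [t1]. *)
  have l1 : K * (1 - a x) <= c * (t1 - x).
    apply: le_trans (lip x x3 (ltW x2)); rewrite aE qx.
    apply: (@le_trans _ _ (phi x * q t0 * ((mu E - beta E) * (1 - a x)))); last first.
      by move: aM; lra.
    have N0 : 0 <= q t0 * ((mu E - beta E) * (1 - a x)).
      by rewrite mulr_ge0 ?stay_ge0// mulr_ge0 ?(ltW mub_gt0)// subr_ge0.
    have := ler_wpM2r N0 (phi_le admE x0 (ltW x2)).
    by rewrite /K !mulrA.
  have xe : t1 - x <= eta.
    move: x1; rewrite gt_max => /andP[_ /ltW]; rewrite lerBlDr addrC -lerBlDr.
    exact.
  have l2 : K * (m * hazard E 0 * (1 - a x)) <= K * delta.
    have mh0 := mulr_gt0 m0 h0_gt0.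
    have mhc := mulr_gt0 mh0 c0.
    have := ler_wpM2l (ltW mh0) (le_trans l1 (ler_wpM2l (ltW c0) xe)).
    rewrite [in X in _ <= X -> _]mulrA [in X in _ <= X -> _]mulrC /eta divfK ?gt_eqF//.
    by rewrite mulrCA (mulrC delta).
  rewrite ler_pM2l// in l2.
  have l3 : m * hazard E x * (1 - a x) <= m * hazard E 0 * (1 - a x).
    by rewrite ler_wpM2r ?subr_ge0// ler_wpM2l ?(ltW m0)// hazard_le.
  have l4 : B * phiP E <= B * hazard E x.
    rewrite ler_wpM2l ?(ltW B0)// -tauP_def hazard_le// ltW//.
    exact: lt_trans t1lt.
  by move: l2 l3 l4; rewrite /delta; lra.
have qsp : 0 < q s by rewrite -qs qq.
have [_ Ms] := above s s0 (a_lt _ s1 s2) qsp.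
by rewrite mul0r; move: Ms aM; lra.
Qed.

(** * Gaps and atoms once every fake is accepted *)

Lemma no_fake_atom (x : \bar R) : (0 <= x)%E -> ~~ is_atom FA x.
Proof.
move=> x0; apply/negP => at_x; have cx : charged FA x by left.
have [t [xt t0 _ _]] := fake_early x0 cx.
have := atom_rejected admE picA t0; rewrite -xt => /(_ at_x).
by move/eqP; rewrite always_accepted// oner_eq0.
Qed.

Lemma no_fake_while_waiting s t : 0 <= s -> s < t -> t <= tauP ->
  cdf_of FP s = cdf_of FP t -> ~ charged FA s%:E.
Proof.
move=> s0 st tt Fst cs; have t0 := le_trans s0 (ltW st).
have s0E : (0 <= s%:E)%E by rewrite lee_fin.
have [_ [[<-] _ stau /(_ t t0)]] := fake_early s0E cs.
rewrite !(vA_accepted E FP (always_accepted _))// leNgt => /negP; apply.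
have q0 : 0 < q s by rewrite subr_gt0 cdfP_lt1.
have ptau : 0 < phi tauP by apply: phi_gt0 => //; exact: ltW.
have B0 : 0 < beta E * (1 - mu E).
  by rewrite mulr_gt0 ?beta_gt0// subr_gt0 mu_lt1.
have dl : 0 < beta E * (1 - mu E) * (phiP E - phiA E) by rewrite mulr_gt0// subr_gt0.
have qst : q t = q s by rewrite /stay Fst.
(* Before [tauP] the hazard is at least [phiP], hence above [phiA], and [phi] is at least
   [phi tauP]: this constant bounds the drift below. *)
have := @acceptedA_incr_ge _ E a FP admE
  (q s * (phi tauP * (beta E * (1 - mu E) * (phiP E - phiA E)))) s t s0 (ltW st) qst.
move=> H; rewrite -subr_gt0; apply: lt_le_trans (H _) => [|x sx xt].
  by rewrite mulr_gt0 ?subr_gt0// mulr_gt0// mulr_gt0.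
have x0 := le_trans s0 (ltW sx).
have xtau := le_trans (ltW xt) tt.
rewrite always_accepted// subrr mulr0 subr0 ler_wpM2l ?(ltW q0)//.
apply: ler_pM; [exact: ltW|exact: ltW|exact: phi_le|].
by rewrite ler_wpM2l ?(ltW B0)// lerB// -tauP_def hazard_le.
Qed.

Lemma no_stop_while_unfaked s t : 0 <= s -> s < t -> t <= tauP ->
  cdf_of FA s = cdf_of FA t -> v s < v t.
Proof.
move=> s0 st tt Fst; apply: vP_increasing_unfaked => //.
  by rewrite -tauP_def hazard_le// (le_trans s0 (ltW st)).
by move=> x sx _; apply: no_fake_atom; rewrite lee_fin (le_trans s0 (ltW sx)).
Qed.

Lemma cdfP_no_gap s t : 0 <= s -> s < t -> t <= tauP ->
  0 < cdf_of FP t -> cdf_of FP s < cdf_of FP t.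
Proof.
move=> s0 st tt Ft0; have t0 := le_trans s0 (ltW st).
rewrite lt_neqAle cdf_of_nondecreasing ?(ltW st)// andbT; apply/negP => /eqP Fst.
(* The gap is extended to its left end, which is a limit of stopping times and so optimal for the
   principal. *)
have [r [r0 rt Frt H]] := cdf_of_first_time FP t0.
have rs : r <= s.
  by rewrite leNgt; apply/negP => sr; have := H s s0 sr; rewrite Fst ltxx.
have rt' : r < t := le_lt_trans rs st.
have rpos : 0 < r.
  rewrite lt_neqAle r0 andbT; apply/negP => /eqP r00.
  by move: Ft0; rewrite -Frt -r00 cdfP_0 ltxx.
(* A fake needs part of the gap still ahead of it to be suboptimal, which holds up to the midpoint
   but may fail at [t]. *)
pose m := (r + t) / 2.
have rm : r < m by rewrite /m; lra.
have mt : m < t by rewrite /m; lra.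
have Fx x : r <= x -> x < t -> cdf_of FP x = cdf_of FP t.
  move=> rx xt; apply/eqP; rewrite eq_le cdf_of_nondecreasing ?(le_trans r0)//= ?(ltW xt)//.
  by rewrite -Frt cdf_of_nondecreasing.
have FA_rm : cdf_of FA m = cdf_of FA r.
  apply: uncharged_cdf_eq => // [|x rx xm]; first exact: ltW.
  have xt := le_lt_trans xm mt.
  by apply: (no_fake_while_waiting (le_trans r0 (ltW rx)) xt tt); rewrite Fx// ltW.
have mtau : m <= tauP by rewrite (le_trans (ltW mt)).
have := no_stop_while_unfaked r0 rm mtau (esym FA_rm).
rewrite ltNge => /negP; apply; apply: stop_limit_optimal => //.
  exact: le_trans r0 (ltW rm).
by move=> x x0 xr; rewrite Frt H.
Qed.

Lemma equilibrium_structure : exists2 tauM : R, 0 < tauM &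
  [/\ support_of FA = [set x | (tauM%:E <= x <= tauP%:E)%E],
      support_of FP = [set x | (tauM%:E <= x <= tauP%:E)%E] &
      forall x : \bar R, (0 <= x)%E -> is_atom FP x -> x = tauP%:E].
Proof.
have tp := ltW tauP_gt0.
(* The supremum of these times, when stopping still has probability 0, will be [tauM]. *)
pose X := [set t | 0 <= t /\ cdf_of FP t = 0].
have [e e0 Fe] := stop_after_delay.
have Xe : X e by split => //; exact: ltW.
have Xub : ubound X tauP.
  move=> t [t0 Ft]; rewrite leNgt; apply/negP => /ltW/cdfP_tauP.
  by move/eqP; rewrite Ft eq_sym oner_eq0.
have hX : has_sup X by split; [exists e|exists tauP].
pose M := sup X.
have M0 : 0 < M by apply: lt_le_trans e0 _; apply: ub_le_sup => //; exists tauP.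
have Mtau : M <= tauP by apply: ge_sup => //; exists e.
have FP0 t : 0 <= t -> t < M -> cdf_of FP t = 0.
  move=> t0 tM; have d0 : 0 < M - t by rewrite subr_gt0.
  have [r [r0 Fr] tr] := sup_adherent d0 hX.
  apply/eqP; rewrite eq_le cdf_of_ge0 andbT -Fr cdf_of_nondecreasing//.
  by move: tr; rewrite subKr => /ltW.
have FPpos t : M < t -> 0 < cdf_of FP t.
  move=> Mt; rewrite lt_neqAle cdf_of_ge0 andbT; apply/negP => /eqP Ft.
  have : X t by split => //; exact: ltW (lt_trans M0 Mt).
  by move=> /(ub_le_sup (ex_intro _ tauP Xub)); rewrite leNgt Mt.
have FPinc s t : M <= s -> s < t -> t <= tauP -> cdf_of FP s < cdf_of FP t.
  move=> Ms st tt; apply: cdfP_no_gap => //; first exact: le_trans (ltW M0) Ms.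
  by apply: FPpos; exact: le_lt_trans st.
have noFA r : 0 <= r -> r < M -> ~ charged FA r%:E.
  move=> r0 rM; pose t := (r + M) / 2.
  have rt : r < t by rewrite /t; lra.
  have tM : t < M by rewrite /t; lra.
  apply: (no_fake_while_waiting r0 rt); first exact: le_trans (ltW tM) Mtau.
  by rewrite !FP0// (le_trans r0 (ltW rt)).
have FA0 t : 0 <= t -> t < M -> cdf_of FA t = 0.
  move=> t0 tM; apply: uncharged_cdf_eq0 => // r r0 rt; apply: noFA => //.
  exact: le_lt_trans tM.
(* [FA] charges some time, which lies before [tauP] but not before [M]. *)
have MltT : M < tauP.
  rewrite lt_neqAle Mtau andbT; apply/negP => /eqP ME.
  have [x x0 cx] := ex_charged FA.
  have [t [xt t0 tt _]] := fake_early x0 cx.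
  by apply: (noFA t) => //; [rewrite ME|rewrite -xt].
(* In a gap of [FA] every stop up to the midpoint would be strictly beaten by waiting until [t],
   leaving a gap in [FP] as well. *)
have FAinc s t : M <= s -> s < t -> t <= tauP -> cdf_of FA s < cdf_of FA t.
  move=> Ms st tt; have s0 := le_trans (ltW M0) Ms.
  rewrite lt_neqAle cdf_of_nondecreasing ?(ltW st)// andbT; apply/negP => /eqP Fst.
  pose m := (s + t) / 2.
  have sm : s < m by rewrite /m; lra.
  have mt : m < t by rewrite /m; lra.
  have := FPinc s m Ms sm (le_trans (ltW mt) tt).
  rewrite (@uncharged_cdf_eq _ FP s m s0 (ltW sm)) ?ltxx// => r sr rm cr.
  have r0 := le_trans s0 (ltW sr); have rt := le_lt_trans rm mt.
  have Frt : cdf_of FA r = cdf_of FA t.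
    apply/eqP; rewrite eq_le cdf_of_nondecreasing ?(ltW rt)//= -Fst.
    by rewrite cdf_of_nondecreasing// ltW.
  have := no_stop_while_unfaked r0 rt tt Frt.
  rewrite ltNge => /negP; apply; apply: stop_optimal => //.
  exact: le_trans r0 (ltW rt).
have FA1 : cdf_of FA tauP = 1.
  by apply: uncharged_cdf_eq1 => // x /ltW; exact: no_late_fake.
exists M => //; split.
- exact: support_of_itv.
- by apply: support_of_itv => //; exact: cdfP_tauP.
move=> x x0 at_x; have cx : charged FP x by left.
have [t [xt t0 tt _ _]] := charged_principal x0 cx.
rewrite xt; congr EFin; apply/eqP; rewrite eq_le tt leNgt; apply/negP => ttau.
pose p := fine (law FP [set t%:E]).
have p0 : 0 < p.
  rewrite -lte_fin /p fineK; last by apply: law_fin; exact: emeasurable_set1.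
  by move: at_x; rewrite /is_atom xt.
have atom_le s : s < t -> cdf_of FP s + p <= cdf_of FP t by exact: cdf_of_atom_le.
have Mt : M <= t.
  (* A negative time, so that [t = 0] is covered. *)
  rewrite leNgt; apply/negP => tM; have [r r0 rt] : exists2 r, -1 <= r & r < t.
    by exists (-1) => //; apply: lt_le_trans t0; rewrite oppr_lt0.
  have := atom_le r rt; rewrite (FP0 t)// leNgt => /negP; apply.
  by rewrite ltr_wpDl ?cdf_of_ge0.
have tpos : 0 < t := lt_le_trans M0 Mt.
have ptau : 0 < phi tauP by exact: phi_gt0.
have Kp : 0 < (mu E - beta E) * (phi tauP * p) by rewrite mulr_gt0// mulr_gt0.
(* Over a span of [2 * d] around the atom, [J] grows by at most half of what a fake loses by coming
   after it. *)
pose d := Num.min (tauP - t) ((mu E - beta E) * (phi tauP * p) / (4 * hazard E 0)).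
have h40 : 0 < 4 * hazard E 0 by rewrite mulr_gt0.
have d0 : 0 < d by rewrite lt_min subr_gt0 ttau divr_gt0.
have dK : hazard E 0 * (2 * d) < (mu E - beta E) * (phi tauP * p).
  have : d <= (mu E - beta E) * (phi tauP * p) / (4 * hazard E 0) by rewrite ge_min lexx orbT.
  by rewrite ler_pdivlMr//; move: Kp; lra.
have td : t + d <= tauP by rewrite -lerBrDl ge_min lexx.
have tdlt : t < t + d by rewrite ltrDl.
have := FAinc t (t + d) Mt tdlt td.
rewrite (@uncharged_cdf_eq _ FA t (t + d) t0 (ltW tdlt)) ?ltxx// => r tr rd cr.
have r0 := le_trans t0 (ltW tr).
(* Faking at [s], just before the atom, strictly beats faking at any [r] in []t, t + d]]. *)
pose s := Num.max 0 (t - d).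
have s0 : 0 <= s by rewrite le_max lexx.
have st : s < t by rewrite gt_max tpos gtrBl.
have sr := lt_trans st tr.
have r0E : (0 <= r%:E)%E by rewrite lee_fin.
have [_ [[<-] _ _ /(_ s s0)]] := fake_early r0E cr.
rewrite !(vA_accepted E FP (always_accepted _))// leNgt => /negP; apply.
have Jle := J_incr_le a FP admE s0 (ltW sr).
have rs2 : r - s <= 2 * d.
  have : t - d <= s by rewrite le_max lexx orbT.
  by move: rd; lra.
have Jd : hazard E 0 * q s * (r - s) <= hazard E 0 * (2 * d).
  have rs0 : 0 <= r - s by rewrite subr_ge0 ltW.
  apply: (@le_trans _ _ (hazard E 0 * (r - s))).
    by rewrite ler_wpM2r// -[leRHS]mulr1 ler_wpM2l ?stay_le1// ltW.
  by rewrite ler_wpM2l// ltW.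
have qr : q r <= q s - p.
  have := cdf_of_nondecreasing FP t0 (ltW tr); have := atom_le s st.
  by rewrite /stay; lra.
have rtau : r <= tauP := le_trans rd td.
have pq : phi r * q r <= phi s * q s - phi tauP * p.
  apply: (@le_trans _ _ (phi s * (q s - p))).
    by apply: ler_pM; rewrite ?stay_ge0 ?phi_le ?(ltW sr)//; exact/ltW/phi_gt0.
  rewrite mulrBr lerB// ler_wpM2r ?(ltW p0)// phi_le//.
  exact: le_trans (ltW sr) rtau.
have := ler_wpM2r (ltW mub_gt0) pq.
by move: Jle Jd dK; rewrite /acceptedA; lra.
Qed.

End Equilibrium.

Unset Implicit Arguments.

Theorem proposition1 (R : realType) (E : game R) (tauP : R)
    (a : acceptance R) (FP FA : timing R)
    (admE : admissible E)
    (A1 : lim (hazard E t @[t --> +oo]) < phiP E < hazard E 0)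
    (A2 : phiA E < phiP E)
    (tauP_gt0 : 0 < tauP)
    (tauP_def : hazard E tauP = phiP E)
    (eqm : equilibrium E a FP FA)
    (ben : beneficial_search E a FP FA) :
  exists2 tauM : R, 0 < tauM &
    [/\ ((forall x : \bar R, (0 <= x)%E -> ~~ is_atom FA x) /\
         support_of FA = [set x | (tauM%:E <= x <= tauP%:E)%E]),
        (support_of FP = [set x | (tauM%:E <= x <= tauP%:E)%E] /\
         (forall x : \bar R, (0 <= x)%E -> is_atom FP x -> x = tauP%:E)) &
        (forall t : R, 0 <= t -> a t = 1)].
Proof.
have [aic picA picT] := eqm.
have [M M0 [sA sP atP]] :=
  equilibrium_structure admE A2 tauP_gt0 tauP_def aic picA picT ben.
exists M => //; split.
- by split => //; exact: no_fake_atom admE A2 tauP_gt0 tauP_def aic picA picT ben.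
- by split.
- exact: always_accepted admE A2 tauP_gt0 tauP_def aic picA picT ben.
Qed.
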